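(* Let $V$ be a finite dimensional indecomposable and reducible (i.e. not irreducible) module over the Green algebra $R(H_{n,d})$. Then there exists an integer $k$ with $0\leq k\leq n-1$ and $d\nmid k$ such that $V\cong V(k)$.
   Context: Let $K$ be an algebraically closed field of characteristic $0$, let $n,d\geq 2$ be integers with $d\mid n$, put $m=n/d$, and let $q\in K$ be a primitive $d$-th root of unity. The generalized Taft algebra $H_{n,d}=H_{n,d}(q)$ is the $K$-algebra generated by $g,h$ subject to $g^n=1$, $h^d=0$, $hg=qgh$; it is a Hopf algebra of dimension $nd$ with $\Delta(g)=g\otimes g$, $\Delta(h)=1\otimes h+h\otimes g$, $\varepsilon(g)=1$, $\varepsilon(h)=0$, $S(g)=g^{-1}$, $S(h)=-q^{-1}g^{n-1}h$. Modules are finite dimensional left modules; tensor products of $H_{n,d}$-modules are over $K$ with action through $\Delta$. Fix a primitive $n$-th root of unity $\omega\in K$ with $\omega^m=q$. For $1\leq l\leq d$ and $i\in\mathbb{Z}_n=\mathbb{Z}/(n)$, $M(l,i)$ is the $H_{n,d}$-module with basis $v_0,\dots,v_{l-1}$ and action $g\cdot v_j=\omega^i q^{-j}v_j$, $h\cdot v_j=v_{j+1}$ for $0\le j\leq l-2$, $h\cdot v_{l-1}=0$. These form a complete list of pairwise non-isomorphic indecomposable $H_{n,d}$-modules. The Green ring $r(H)$ of a Hopf algebra $H$ is the abelian group generated by isomorphism classes $[V]$ of finite dimensional $H$-modules modulo $[V\oplus W]=[V]+[W]$, with multiplication $[V][W]=[V\otimes W]$. The Green algebra is $R(H)=\mathbb{C}\otimes_{\mathbb{Z}}r(H)$.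 The algebra $R(H_{n,d})$ is identified with $\mathbb{C}[y,z]/(y^n-1,\ (z-y^m-1)F_d(y^m,z))$ via $y=[M(1,-1)]$, $z=[M(2,0)]$, where $F_0(y,z)=0$, $F_1(y,z)=1$, $F_{s+2}(y,z)=zF_{s+1}(y,z)-yF_s(y,z)$. For $0\leq k\leq n-1$ put $\omega_k=\cos\frac{2k\pi}{n}+i\sin\frac{2k\pi}{n}\in\mathbb{C}$. For $0\leq k\leq n-1$ with $d\nmid k$, $V(k)$ is the $R(H_{n,d})$-module with $\mathbb{C}$-basis $\{v_1,v_2\}$ and action $y\cdot v_i=\omega_k v_i$ ($i=1,2$), $z\cdot v_1=(1+\omega_k^m)v_1$, $z\cdot v_2=v_1+(1+\omega_k^m)v_2$. *)

(* Defs.v *)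
From HB Require Import structures.
From mathcomp Require Import all_boot all_order all_algebra.
From mathcomp Require Import boolp reals trigo.
From mathcomp Require Import finmap.
From mathcomp.multinomials Require Import monalg.
From mathcomp.real_closed Require Import complex mxtens.

Set Implicit Arguments.
Unset Strict Implicit.
Unset Printing Implicit Defensive.

Import GRing.Theory.
Local Open Scope ring_scope.

Local Notation "A *t B" := (tensmx A B)
  (at level 40, left associativity, format "A  *t  B").

(* The q-binomial theorem at a root of unity: h acts nilpotently, of the right
   order, on a tensor product of H_{n,d}-modules. *)
Section QBinomial.
Variable K : fieldType.
Implicit Type q : K.

Fixpoint qbin q (m k : nat) : K :=
  match m, k with
  | _, 0 => 1
  | 0, _.+1 => 0
  | m.+1, k.+1 => q ^+ k.+1 * qbin q m k.+1 + qbin q m k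
  end.

Lemma qbin_gt q m k : (m < k)%N -> qbin q m k = 0.
Proof.
elim: m k => [|m IHm] [|k] //= lt_mk.
by rewrite !IHm ?mulr0 ?addr0 // ltnW.
Qed.

Lemma qbinn q m : qbin q m m = 1.
Proof. by elim: m => //= m ->; rewrite qbin_gt // mulr0 add0r. Qed.

Lemma qbin0 q m : qbin q m 0 = 1.
Proof. by case: m. Qed.

Lemma qbin_prod q m k :
  qbin q m k * \prod_(i < k) (1 - q ^+ i.+1) = \prod_(i < k) (1 - q ^+ (m - i)).
Proof.
elim: m k => [|m IHm] [|k]; rewrite ?big_ord0 ?qbin0 ?mulr1 //=.
  by rewrite mul0r big_ord_recl /= sub0n expr0 subrr mul0r.
rewrite mulrDl -mulrA IHm big_ord_recr /= [in X in _ + X]big_ord_recr /=.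
rewrite [qbin q m k * _]mulrA IHm [RHS]big_ord_recl /= subn0.
rewrite [in RHS](eq_bigr (fun i : 'I_k => 1 - q ^+ (m - i))) => [|i _]; last first.
  by rewrite /bump leq0n add1n subSS.
rewrite mulrCA -mulrDr [RHS]mulrC.
have [le_km | lt_mk] := leqP k m.
  by rewrite mulrBr mulr1 -exprD addSn subnKC // addrC addrA subrK.
suff -> : \prod_(i < k) (1 - q ^+ (m - i)) = 0 by rewrite !mul0r.
by rewrite (bigD1 (Ordinal lt_mk)) //= subnn expr0 subrr mul0r.
Qed.

Lemma qbin_prim d q k : d.-primitive_root q -> (0 < k < d)%N -> qbin q d k = 0.
Proof.
move=> hq /andP[k_gt0 lt_kd].
have/eqP := qbin_prod q d k; rewrite -[k in X in _ == X](prednK k_gt0).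
rewrite big_ord_recl /= subn0 (prim_expr_order hq) subrr mul0r mulf_eq0.
case/orP=> [/eqP // | /prodf_eq0[i _]]; rewrite subr_eq0 eq_sym.
rewrite -(prim_order_dvd hq) => /dvdn_leq; rewrite ltnS.
by move=> /(_ isT) le_di; have := leq_trans lt_kd le_di; rewrite ltnS leqNgt ltn_ord.
Qed.

Lemma qbinomial q r (A B : 'M[K]_r) m :
  A *m B = q *: (B *m A) ->
  (A + B) ^+ m = \sum_(k < m.+1) qbin q m k *: (B ^+ k *m A ^+ (m - k)).
Proof.
move=> AB; have ABk k : A *m B ^+ k = q ^+ k *: (B ^+ k *m A).
  elim: k => [|k IHk]; first by rewrite !expr0 scale1r mulmx1 mul1mx.
  rewrite exprSr -[_ * B]/(_ *m B) mulmxA IHk -scalemxAl -mulmxA AB.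
  by rewrite -scalemxAr scalerA mulmxA -exprSr.
elim: m => [|m IHm].
  by rewrite big_ord_recl big_ord0 /= !expr0 addr0 scale1r mulmx1.
rewrite exprS -[_ * _]/(_ *m _) IHm mulmxDl !mulmx_sumr.
rewrite [RHS]big_ord_recl /= scale1r subn0 mul1mx.
under [in RHS]eq_bigr => i _ do
  rewrite /bump leq0n add1n subSS scalerDl.
rewrite big_split /= addrA; congr (_ + _); last first.
  apply: eq_bigr => i _; rewrite -scalemxAr mulmxA.
  by rewrite -[B *m B ^+ i]/(B * B ^+ i) -exprS.
rewrite big_ord_recl /= subn0 qbin0 scale1r mul1mx -[A *m _]/(A * _) -exprS.
congr (_ + _); rewrite [RHS]big_ord_recr /= qbin_gt // mulr0 scale0r addr0.
apply: eq_bigr => i _; rewrite /bump leq0n add1n.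
rewrite -scalemxAr mulmxA ABk -scalemxAl scalerA mulrC -mulmxA.
by rewrite -[A *m _]/(A * _) -exprS subnSK.
Qed.

Lemma qnilp d q r (A B : 'M[K]_r) : d.-primitive_root q ->
  A *m B = q *: (B *m A) -> A ^+ d = 0 -> B ^+ d = 0 -> (A + B) ^+ d = 0.
Proof.
move=> hq /(qbinomial d) -> Ad Bd; apply: big1 => k _.
have [->|k_gt0] := posnP k; first by rewrite subn0 Ad mulmx0 scaler0.
have := ltn_ord k; rewrite ltnS leq_eqVlt => /predU1P[->|lt_kd].
  by rewrite Bd mul0mx scaler0.
by rewrite (qbin_prim hq) ?k_gt0 // scale0r.
Qed.

End QBinomial.

Section TensMx.
Variable K : comNzRingType.

Lemma tensmxDl m n p q (A A' : 'M[K]_(m, n)) (B : 'M_(p, q)) :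
  (A + A') *t B = A *t B + A' *t B.
Proof. by apply/matrixP=> i j; rewrite !mxE mulrDl. Qed.

Lemma tensmxDr m n p q (A : 'M[K]_(m, n)) (B B' : 'M_(p, q)) :
  A *t (B + B') = A *t B + A *t B'.
Proof. by apply/matrixP=> i j; rewrite !mxE mulrDr. Qed.

Lemma tensmxZr m n p q a (A : 'M[K]_(m, n)) (B : 'M_(p, q)) :
  A *t (a *: B) = a *: (A *t B).
Proof. by apply/matrixP=> i j; rewrite !mxE mulrCA. Qed.

Lemma tensmxZl m n p q a (A : 'M[K]_(m, n)) (B : 'M_(p, q)) :
  (a *: A) *t B = a *: (A *t B).
Proof. by apply/matrixP=> i j; rewrite !mxE mulrA. Qed.

Lemma tensmx11 m n : (1%:M : 'M[K]_m) *t (1%:M : 'M_n) = 1%:M.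
Proof.
apply/matrixP=> i j; case: (mxtens_indexP i) => i1 i2.
case: (mxtens_indexP j) => j1 j2; rewrite tensmxE !mxE -natrM mulnb.
by rewrite (can_eq (@mxtens_indexK _ _)).
Qed.

Lemma tensmxX m n (A : 'M[K]_m) (B : 'M_n) k : (A *t B) ^+ k = A ^+ k *t B ^+ k.
Proof.
elim: k => [|k IHk]; first by rewrite !expr0 [RHS]tensmx11.
by rewrite !exprS -[LHS]/(_ *m _) IHk -tensmx_mul.
Qed.

End TensMx.

(* A finite dimensional left H_{n,d}(q)-module, up to isomorphism: by the
   presentation of H_{n,d}(q), two square matrices acting on column vectors and
   satisfying g^n = 1, h^d = 0, hg = qgh. *)
Record taftMod (K : fieldType) (n d : nat) (q : K) := TaftMod {
  tdim : nat;
  tg : 'M[K]_tdim;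
  th : 'M[K]_tdim;
  tgX : tg ^+ n = 1%:M;
  thX : th ^+ d = 0;
  thg : th *m tg = q *: (tg *m th) }.
Arguments TaftMod {K n d q tdim tg th}.

HB.instance Definition _ (K : fieldType) n d (q : K) :=
  gen_eqMixin (taftMod n d q).
HB.instance Definition _ (K : fieldType) n d (q : K) :=
  gen_choiceMixin (taftMod n d q).

Section TaftMod.
Variables (K : fieldType) (n d : nat) (q : K).
Local Notation tmod := (taftMod n d q).
Implicit Types U V W X : tmod.

Definition tiso V W : Prop :=
  exists (P : 'M[K]_(tdim W, tdim V)) (Q : 'M[K]_(tdim V, tdim W)),
    [/\ P *m Q = 1%:M, Q *m P = 1%:M,
        P *m tg V = tg W *m P & P *m th V = th W *m P].

Lemma tiso_reindex V W (f : 'I_(tdim W) -> 'I_(tdim V)) f' :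
    cancel f f' -> cancel f' f ->
    (forall i j, tg W i j = tg V (f i) (f j)) ->
    (forall i j, th W i j = th V (f i) (f j)) ->
  tiso V W.
Proof.
move=> fK f'K Eg Eh; pose P : 'M[K]_(tdim W, tdim V) := \matrix_(i, j) (f i == j)%:R.
have PE m (A : 'M[K]_(tdim V, m)) : P *m A = \matrix_(i, j) A (f i) j.
  apply/matrixP=> i j; rewrite !mxE (bigD1 (f i)) //= mxE eqxx mul1r.
  by rewrite big1 ?addr0 // => k; rewrite mxE eq_sym => /negbTE->; rewrite mul0r.
have EP m (A : 'M[K]_(m, tdim W)) : A *m P = \matrix_(i, j) A i (f' j).
  apply/matrixP=> i j; rewrite !mxE (bigD1 (f' j)) //= mxE f'K eqxx mulr1.
  rewrite big1 ?addr0 // => k; rewrite mxE (can2_eq fK f'K) => /negbTE->.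
  by rewrite mulr0.
exists P, (\matrix_(i, j) (f' i == j)%:R); rewrite !PE !EP; split.
- by apply/matrixP=> i j; rewrite !mxE fK.
- by apply/matrixP=> i j; rewrite !mxE (can_eq f'K).
- by apply/matrixP=> i j; rewrite !mxE Eg f'K.
- by apply/matrixP=> i j; rewrite !mxE Eh f'K.
Qed.

Lemma tiso_refl V : tiso V V.
Proof. exact: (@tiso_reindex V V id id). Qed.

Lemma tiso_dim V W : tiso V W -> tdim V = tdim W.
Proof.
case=> P [Q [PQ QP _ _]]; apply/anti_leq/andP; split.
  by have := mulmx1_min QP.
by have := mulmx1_min PQ.
Qed.

Fact tunit_g : 1%:M ^+ n = 1%:M :> 'M[K]_1.
Proof. exact: expr1n. Qed.
Fact tunit_hg : 0 *m 1%:M = q *: (1%:M *m 0) :> 'M[K]_1.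
Proof. by rewrite mul0mx mulmx0 scaler0. Qed.

Fact tplus_g V W : block_mx (tg V) 0 0 (tg W) ^+ n = 1%:M.
Proof.
suff E k : block_mx (tg V) 0 0 (tg W) ^+ k = block_mx (tg V ^+ k) 0 0 (tg W ^+ k).
  by rewrite E !tgX -scalar_mx_block.
elim: k => [|k IHk]; first by rewrite !expr0 -scalar_mx_block.
rewrite !exprS -[LHS]/(_ *m _) IHk mulmx_block.
by rewrite !(mul0mx, mulmx0, addr0, add0r).
Qed.

Fact tplus_h V W : block_mx (th V) 0 0 (th W) ^+ d = 0.
Proof.
suff E k : block_mx (th V) 0 0 (th W) ^+ k = block_mx (th V ^+ k) 0 0 (th W ^+ k).
  by rewrite E !thX -block_mx0.
elim: k => [|k IHk]; first by rewrite !expr0 -scalar_mx_block.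
rewrite !exprS -[LHS]/(_ *m _) IHk mulmx_block.
by rewrite !(mul0mx, mulmx0, addr0, add0r).
Qed.

Fact tplus_hg V W :
  block_mx (th V) 0 0 (th W) *m block_mx (tg V) 0 0 (tg W) =
  q *: (block_mx (tg V) 0 0 (tg W) *m block_mx (th V) 0 0 (th W)).
Proof.
rewrite !mulmx_block !(mul0mx, mulmx0, addr0, add0r).
by rewrite scale_block_mx !scaler0 !thg.
Qed.

Definition tplus V W : tmod := TaftMod (tplus_g V W) (tplus_h V W) (tplus_hg V W).

Hypothesis hq : d.-primitive_root q.

Fact tunit_h : 0 ^+ d = 0 :> 'M[K]_1.
Proof. by rewrite expr0n gtn_eqF // (prim_order_gt0 hq). Qed.

(* The trivial module, given by the counit. *)
Definition tunit : tmod := TaftMod tunit_g tunit_h tunit_hg.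

Fact tmul_g V W : (tg V *t tg W) ^+ n = 1%:M.
Proof. by rewrite tensmxX !tgX tensmx11. Qed.

Fact tmul_h V W : (1%:M *t th W + th V *t tg W) ^+ d = 0.
Proof.
apply: (qnilp hq).
- by rewrite !tensmx_mul mul1mx mulmx1 thg tensmxZr.
- by rewrite tensmxX thX tensmx0.
- by rewrite tensmxX thX tens0mx.
Qed.

Fact tmul_hg V W :
  (1%:M *t th W + th V *t tg W) *m (tg V *t tg W) =
  q *: ((tg V *t tg W) *m (1%:M *t th W + th V *t tg W)).
Proof.
rewrite mulmxDl mulmxDr !tensmx_mul mul1mx mulmx1 !thg.
by rewrite tensmxZr tensmxZl scalerDr.
Qed.

(* The action through Delta(g) = g (x) g, Delta(h) = 1 (x) h + h (x) g. *)
Definition tmul V W : tmod := TaftMod (tmul_g V W) (tmul_h V W) (tmul_hg V W).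

Lemma tmul_isol U V W : tiso V W -> tiso (tmul V U) (tmul W U).
Proof.
case=> P [Q [PQ QP Pg Ph]]; exists (P *t 1%:M), (Q *t 1%:M); split=> /=.
- by rewrite tensmx_mul PQ mulmx1 tensmx11.
- by rewrite tensmx_mul QP mulmx1 tensmx11.
- by rewrite !tensmx_mul Pg mul1mx mulmx1.
- by rewrite mulmxDl mulmxDr !tensmx_mul Ph !mul1mx !mulmx1.
Qed.

Lemma tmul_isor U V W : tiso V W -> tiso (tmul U V) (tmul U W).
Proof.
case=> P [Q [PQ QP Pg Ph]]; exists (1%:M *t P), (1%:M *t Q); split=> /=.
- by rewrite tensmx_mul PQ mulmx1 tensmx11.
- by rewrite tensmx_mul QP mulmx1 tensmx11.
- by rewrite !tensmx_mul Pg mul1mx mulmx1.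
- by rewrite mulmxDl mulmxDr !tensmx_mul Pg Ph !mul1mx !mulmx1.
Qed.

Lemma tmul1V V : tiso V (tmul tunit V).
Proof.
pose f (i : 'I_(1 * tdim V)) := (mxtens_unindex i).2.
apply: (@tiso_reindex V (tmul tunit V) f (fun i => mxtens_index (ord0, i))).
- by move=> i; case: (mxtens_indexP i) => i1 i2; rewrite /f mxtens_indexK [i1]ord1.
- by move=> i; rewrite /f mxtens_indexK.
- by move=> i j; rewrite !mxE !ord1 mul1r.
- by move=> i j; rewrite !mxE !ord1 mul1r mul0r addr0.
Qed.

Lemma tmulV1 V : tiso V (tmul V tunit).
Proof.
pose f (i : 'I_(tdim V * 1)) := (mxtens_unindex i).1.
apply: (@tiso_reindex V (tmul V tunit) f (fun i => mxtens_index (i, ord0))).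
- by move=> i; case: (mxtens_indexP i) => i1 i2; rewrite /f mxtens_indexK [i2]ord1.
- by move=> i; rewrite /f mxtens_indexK.
- by move=> i j; rewrite !mxE !ord1 mulr1.
- by move=> i j; rewrite !mxE !ord1 mulr0 add0r mulr1.
Qed.

Lemma tmulA U V W : tiso (tmul U (tmul V W)) (tmul (tmul U V) W).
Proof.
pose f (i : 'I_(tdim U * tdim V * tdim W)) : 'I_(tdim U * (tdim V * tdim W)) :=
  let: (ab, c) := mxtens_unindex i in let: (a, b) := mxtens_unindex ab in
  mxtens_index (a, mxtens_index (b, c)).
pose f' (i : 'I_(tdim U * (tdim V * tdim W))) : 'I_(tdim U * tdim V * tdim W) :=
  let: (a, bc) := mxtens_unindex i in let: (b, c) := mxtens_unindex bc in
  mxtens_index (mxtens_index (a, b), c).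
have fE a b c : f (mxtens_index (mxtens_index (a, b), c)) =
                mxtens_index (a, mxtens_index (b, c)).
  by rewrite /f !mxtens_indexK.
have f'E a b c : f' (mxtens_index (a, mxtens_index (b, c))) =
                 mxtens_index (mxtens_index (a, b), c).
  by rewrite /f' !mxtens_indexK.
apply: (@tiso_reindex (tmul U (tmul V W)) (tmul (tmul U V) W) f f').
- move=> i; case: (mxtens_indexP i) => ab c; case: (mxtens_indexP ab) => a b.
  by rewrite fE f'E.
- move=> i; case: (mxtens_indexP i) => a bc; case: (mxtens_indexP bc) => b c.
  by rewrite f'E fE.
- move=> i j; case: (mxtens_indexP i) => ab c; case: (mxtens_indexP ab) => a b.
  case: (mxtens_indexP j) => xy z; case: (mxtens_indexP xy) => x y.
  by rewrite !fE /= !tensmxE mulrA.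
- move=> i j; case: (mxtens_indexP i) => ab c; case: (mxtens_indexP ab) => a b.
  case: (mxtens_indexP j) => xy z; case: (mxtens_indexP xy) => x y.
  rewrite !fE /= !(mxE, mxtens_indexK) /= (can_eq (@mxtens_indexK _ _)) xpair_eqE.
  rewrite mulrDl mulrDr !mulrA -natrM mulnb -!addrA; congr (_ + (_ + _)).
Qed.

Lemma tmul_plusl U V W : tiso (tplus (tmul U W) (tmul V W)) (tmul (tplus U V) W).
Proof.
pose f (i : 'I_((tdim U + tdim V) * tdim W)) :
    'I_(tdim U * tdim W + tdim V * tdim W) :=
  let: (ab, c) := mxtens_unindex i in
  match split ab with
  | inl a => lshift _ (mxtens_index (a, c))
  | inr b => rshift _ (mxtens_index (b, c))
  end.
pose f' (i : 'I_(tdim U * tdim W + tdim V * tdim W)) :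
    'I_((tdim U + tdim V) * tdim W) :=
  match split i with
  | inl j => let: (a, c) := mxtens_unindex j in mxtens_index (lshift _ a, c)
  | inr j => let: (b, c) := mxtens_unindex j in mxtens_index (rshift _ b, c)
  end.
have fl a c : f (mxtens_index (lshift _ a, c)) = lshift _ (mxtens_index (a, c)).
  by rewrite /f mxtens_indexK (unsplitK (inl a)).
have fr b c : f (mxtens_index (rshift _ b, c)) = rshift _ (mxtens_index (b, c)).
  by rewrite /f mxtens_indexK (unsplitK (inr b)).
have f'l a c : f' (lshift _ (mxtens_index (a, c))) = mxtens_index (lshift _ a, c).
  by rewrite /f' (unsplitK (inl _)) mxtens_indexK.
have f'r b c : f' (rshift _ (mxtens_index (b, c))) = mxtens_index (rshift _ b, c).
  by rewrite /f' (unsplitK (inr _)) mxtens_indexK.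
apply: (@tiso_reindex (tplus (tmul U W) (tmul V W)) (tmul (tplus U V) W) f f').
- move=> i; case: (mxtens_indexP i) => ab c; case: (split_ordP ab) => a ->.
    by rewrite fl f'l.
  by rewrite fr f'r.
- move=> i; case: (split_ordP i) => j ->; case: (mxtens_indexP j) => a c.
    by rewrite f'l fl.
  by rewrite f'r fr.
- move=> i j; case: (mxtens_indexP i) => ab c; case: (mxtens_indexP j) => xy z.
  case: (split_ordP ab) => a ->; case: (split_ordP xy) => x -> /=;
  by rewrite tensmxE !(fl, fr, block_mxEul, block_mxEur, block_mxEdl, block_mxEdr)
    ?tensmxE ?mxE ?mul0r.
- move=> i j; case: (mxtens_indexP i) => ab c; case: (mxtens_indexP j) => xy z.
  case: (split_ordP ab) => a ->; case: (split_ordP xy) => x -> /=;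
  rewrite [LHS]mxE !tensmxE [(1%:M : 'M_(_ + _)) _ _]mxE.
  + by rewrite !fl !block_mxEul [RHS]mxE !tensmxE mxE (inj_eq (@lshift_inj _ _)).
  + by rewrite fl fr !block_mxEur !mxE eq_lrshift !mul0r addr0.
  + by rewrite fl fr !block_mxEdl !mxE eq_rlshift !mul0r addr0.
  + by rewrite !fr !block_mxEdr [RHS]mxE !tensmxE mxE (inj_eq (@rshift_inj _ _)).
Qed.

Lemma tmul_plusr U V W : tiso (tplus (tmul U V) (tmul U W)) (tmul U (tplus V W)).
Proof.
pose f (i : 'I_(tdim U * (tdim V + tdim W))) :
    'I_(tdim U * tdim V + tdim U * tdim W) :=
  let: (c, ab) := mxtens_unindex i in
  match split ab with
  | inl a => lshift _ (mxtens_index (c, a))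
  | inr b => rshift _ (mxtens_index (c, b))
  end.
pose f' (i : 'I_(tdim U * tdim V + tdim U * tdim W)) :
    'I_(tdim U * (tdim V + tdim W)) :=
  match split i with
  | inl j => let: (c, a) := mxtens_unindex j in mxtens_index (c, lshift _ a)
  | inr j => let: (c, b) := mxtens_unindex j in mxtens_index (c, rshift _ b)
  end.
have fl a c : f (mxtens_index (c, lshift _ a)) = lshift _ (mxtens_index (c, a)).
  by rewrite /f mxtens_indexK (unsplitK (inl a)).
have fr b c : f (mxtens_index (c, rshift _ b)) = rshift _ (mxtens_index (c, b)).
  by rewrite /f mxtens_indexK (unsplitK (inr b)).
have f'l a c : f' (lshift _ (mxtens_index (c, a))) = mxtens_index (c, lshift _ a).
  by rewrite /f' (unsplitK (inl _)) mxtens_indexK.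
have f'r b c : f' (rshift _ (mxtens_index (c, b))) = mxtens_index (c, rshift _ b).
  by rewrite /f' (unsplitK (inr _)) mxtens_indexK.
apply: (@tiso_reindex (tplus (tmul U V) (tmul U W)) (tmul U (tplus V W)) f f').
- move=> i; case: (mxtens_indexP i) => c ab; case: (split_ordP ab) => a ->.
    by rewrite fl f'l.
  by rewrite fr f'r.
- move=> i; case: (split_ordP i) => j ->; case: (mxtens_indexP j) => c a.
    by rewrite f'l fl.
  by rewrite f'r fr.
- move=> i j; case: (mxtens_indexP i) => c ab; case: (mxtens_indexP j) => z xy.
  case: (split_ordP ab) => a ->; case: (split_ordP xy) => x -> /=;
  by rewrite tensmxE !(fl, fr, block_mxEul, block_mxEur, block_mxEdl, block_mxEdr)
    ?tensmxE ?mxE ?mulr0.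
- move=> i j; case: (mxtens_indexP i) => c ab; case: (mxtens_indexP j) => z xy.
  case: (split_ordP ab) => a ->; case: (split_ordP xy) => x -> /=;
  rewrite [LHS]mxE !tensmxE.
  + by rewrite !fl !block_mxEul [RHS]mxE !tensmxE.
  + by rewrite fl fr !block_mxEur !mxE !mulr0 addr0.
  + by rewrite fl fr !block_mxEdl !mxE !mulr0 addr0.
  + by rewrite !fr !block_mxEdr [RHS]mxE !tensmxE.
Qed.

End TaftMod.

(* The Green algebra with coefficients in k, that is k (x)_Z r(H_{n,d}(q)): the
   free k-module on the H_{n,d}(q)-modules, modulo [V] = [W] for V isomorphic to
   W and [V (+) W] = [V] + [W]. *)
Section GreenAlgebra.
Variables (k : comNzRingType) (K : fieldType) (n d : nat) (q : K).
Local Notation tmod := (taftMod n d q).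
Local Notation free := {malg k[tmod]}.
Implicit Types (V W X : tmod) (a b : free).

Inductive green_rel : free -> Prop :=
| GreenIso V W : tiso V W -> green_rel (<< V >> - << W >>)
| GreenPlus V W : green_rel (<< tplus V W >> - (<< V >> + << W >>))
| GreenZero : green_rel 0
| GreenLin c a b : green_rel a -> green_rel b -> green_rel (c *: a + b).

Definition green_sub : {pred free} := fun a => `[< green_rel a >].

Lemma green_subP a : reflect (green_rel a) (a \in green_sub).
Proof. exact: asboolP. Qed.

Fact green_sub_zmod : zmod_closed green_sub.
Proof.
split=> [|a b /green_subP ra /green_subP rb]; apply/green_subP.
  exact: GreenZero.
by rewrite addrC -scaleN1r; apply: GreenLin.
Qed.
HB.instance Definition _ := GRing.isZmodClosed.Build free green_sub green_sub_zmod.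

Fact green_subZ c a : a \in green_sub -> c *: a \in green_sub.
Proof.
move=> /green_subP ra; apply/green_subP; rewrite -[c *: a]addr0.
by apply: GreenLin => //; apply: GreenZero.
Qed.

Definition greenAlg (hq : d.-primitive_root q) : Type := Quotient.quot green_sub.

Variable hq : d.-primitive_root q.
Local Notation green := (greenAlg hq).

HB.instance Definition _ := GRing.Zmodule.copy green (Quotient.quot green_sub).
HB.instance Definition _ := EqQuotient.copy green (Quotient.quot green_sub).

Local Notation gpi a := (\pi_(Quotient.quot green_sub)%qT a : green).

Lemma gpi_eq a b : (gpi a == gpi b) = (a - b \in green_sub).
Proof. by rewrite Quotient.idealrBE. Qed.

Lemma gpiD a b : gpi (a + b) = gpi a + gpi b.
Proof. exact: (raddfD (\pi_(Quotient.quot green_sub)%qT)). Qed.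

Definition green_scale (c : k) (x : green) : green := gpi (c *: repr x).

Lemma green_scaleE c a : green_scale c (gpi a) = gpi (c *: a).
Proof.
apply/eqP; rewrite gpi_eq -scalerBr green_subZ //.
by rewrite -gpi_eq reprK.
Qed.

Lemma green_ind (P : green -> Prop) : (forall a, P (gpi a)) -> forall x, P x.
Proof. by move=> Ppi x; rewrite -[x]reprK; apply: Ppi. Qed.

Fact green_scaleA c c' x : green_scale c (green_scale c' x) = green_scale (c * c') x.
Proof. by elim/green_ind: x => a; rewrite !green_scaleE scalerA. Qed.
Fact green_scale1 : left_id 1 green_scale.
Proof. by elim/green_ind=> a; rewrite green_scaleE scale1r. Qed.
Fact green_scaleDr : right_distributive green_scale +%R.
Proof.
move=> c; elim/green_ind=> a; elim/green_ind=> b.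
by rewrite -gpiD !green_scaleE scalerDr gpiD.
Qed.
Fact green_scaleDl x : {morph green_scale^~ x : c c' / c + c'}.
Proof. by move=> c c'; elim/green_ind: x => a; rewrite !green_scaleE scalerDl gpiD. Qed.

HB.instance Definition _ := GRing.Zmodule_isLmodule.Build k green
  green_scaleA green_scale1 green_scaleDr green_scaleDl.

Lemma gpiZ c a : gpi (c *: a) = c *: gpi a.
Proof. by rewrite [RHS]green_scaleE. Qed.

Definition gclass V : green := gpi << V >>.

(* The linear extension of a function on modules that is additive and constant
   on isomorphism classes. *)
Section Lift.
Variables (M : lmodType k) (f : tmod -> M).

Definition malg_lift (a : free) : M := \sum_(V <- msupp a) a@_V *: f V.

Lemma malg_liftEw (D : {fset tmod}) a :
  (msupp a `<=` D)%fset -> malg_lift a = \sum_(V <- D) a@_V *: f V.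
Proof.
move=> aD; apply: big_fset_incl => // V _ /mcoeff_outdom ->.
by rewrite scale0r.
Qed.

Lemma malg_lift_lin c a b :
  malg_lift (c *: a + b) = c *: malg_lift a + malg_lift b.
Proof.
pose D := (msupp a `|` msupp b `|` msupp (c *: a + b))%fset.
have aD : (msupp a `<=` D)%fset by rewrite /D -fsetUA fsubsetUl.
have bD : (msupp b `<=` D)%fset by rewrite /D fsetUAC fsubsetUr.
have abD : (msupp (c *: a + b) `<=` D)%fset by rewrite fsubsetUr.
rewrite (malg_liftEw aD) (malg_liftEw bD) (malg_liftEw abD).
rewrite scaler_sumr -big_split /=; apply: eq_bigr => V _.
by rewrite mcoeffD mcoeffZ scalerDl scalerA.
Qed.

Lemma malg_liftU V : malg_lift << V >> = f V.
Proof. by rewrite (malg_liftEw msuppU_le) big_seq_fset1 mcoeffUU scale1r. Qed.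

Lemma malg_lift0 : malg_lift 0 = 0.
Proof. by rewrite /malg_lift msupp0 big_seq_fset0. Qed.

Definition glift (x : green) : M := malg_lift (repr x).

Hypothesis f_iso : forall V W, tiso V W -> f V = f W.
Hypothesis f_plus : forall V W, f (tplus V W) = f V + f W.

Lemma malg_lift_rel a : green_rel a -> malg_lift a = 0.
Proof.
elim=> [V W /f_iso fVW | V W | | c {}a b _ a0 _ b0].
- by rewrite addrC -scaleN1r malg_lift_lin !malg_liftU fVW scaleN1r addNr.
- rewrite addrC -scaleN1r malg_lift_lin malg_liftU f_plus.
  by rewrite -[<< V >>]scale1r malg_lift_lin !malg_liftU scale1r scaleN1r addNr.
- exact: malg_lift0.
- by rewrite malg_lift_lin a0 b0 scaler0 addr0.
Qed.

Lemma glift_pi a : glift (gpi a) = malg_lift a.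
Proof.
apply/eqP; rewrite -subr_eq0 addrC -scaleN1r -malg_lift_lin scaleN1r addrC.
by apply/eqP/malg_lift_rel/green_subP; rewrite -gpi_eq reprK.
Qed.

Lemma glift_class V : glift (gclass V) = f V.
Proof. by rewrite glift_pi malg_liftU. Qed.

Lemma glift_lin c x y : glift (c *: x + y) = c *: glift x + glift y.
Proof.
elim/green_ind: x => a; elim/green_ind: y => b.
by rewrite -gpiZ -gpiD !glift_pi malg_lift_lin.
Qed.
End Lift.

Lemma glift_eq (M : lmodType k) (f f' : tmod -> M) : f =1 f' -> glift f =1 glift f'.
Proof. by move=> ff' x; apply: eq_bigr => V _; rewrite ff'. Qed.

Lemma gclass_iso V W : tiso V W -> gclass V = gclass W.
Proof. by move=> iVW; apply/eqP; rewrite gpi_eq; apply/green_subP/GreenIso. Qed.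

Lemma gclass_plus V W : gclass (tplus V W) = gclass V + gclass W.
Proof. by rewrite -gpiD; apply/eqP; rewrite gpi_eq; apply/green_subP/GreenPlus. Qed.

Lemma green_span (P : green -> Prop) :
    (forall V, P (gclass V)) -> P 0 -> (forall c x y, P x -> P y -> P (c *: x + y)) ->
  forall x, P x.
Proof.
move=> PV P0 Plin; elim/green_ind=> a; rewrite [a]monalgE.
elim: (msupp a : seq tmod) => [|V s IHs].
  rewrite big_nil; have -> // : gpi 0 = 0 :> green.
  by rewrite -[0 in LHS](scale0r 0) gpiZ scale0r.
rewrite big_cons gpiD; have -> : << a@_V *g V >> = a@_V *: << V >> :> free.
  by apply/malgP=> W; rewrite mcoeffZ !mcoeffU mulr_natr.
by rewrite gpiZ; apply: Plin => [|//]; apply: PV.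
Qed.

(* The bilinear product with [V][W] = [V (x) W]. *)
Definition green_mul (x y : green) : green :=
  glift (fun V => glift (fun W => gclass (tmul hq V W)) y) x.

Let mulf V W := gclass (tmul hq V W).

Let mulf_iso V W W' : tiso W W' -> mulf V W = mulf V W'.
Proof. by move=> iW; apply/gclass_iso/tmul_isor. Qed.

Let mulf_plus V W W' : mulf V (tplus W W') = mulf V W + mulf V W'.
Proof. by rewrite -gclass_plus; apply/esym/gclass_iso/tmul_plusr. Qed.

Let mull y V := glift (mulf V) y.

Let mull_iso y V V' : tiso V V' -> mull y V = mull y V'.
Proof. by move=> iV; apply: glift_eq => W; apply/gclass_iso/tmul_isol. Qed.

Let mull_plus y V V' : mull y (tplus V V') = mull y V + mull y V'.
Proof.
rewrite /mull /glift /malg_lift -big_split; apply: eq_bigr => W _ /=.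
rewrite -scalerDr -gclass_plus; congr (_ *: _).
exact/esym/gclass_iso/tmul_plusl.
Qed.

Lemma gclassM V W : green_mul (gclass V) (gclass W) = gclass (tmul hq V W).
Proof.
rewrite /green_mul (glift_class (mull_iso _) (mull_plus _)).
exact: (glift_class (mulf_iso V) (mulf_plus V)).
Qed.

Lemma green_mul_linl c x x' y :
  green_mul (c *: x + x') y = c *: green_mul x y + green_mul x' y.
Proof. exact: (glift_lin (mull_iso y) (mull_plus y)). Qed.

Lemma green_mul_linr c x y y' :
  green_mul x (c *: y + y') = c *: green_mul x y + green_mul x y'.
Proof.
rewrite /green_mul /glift /malg_lift scaler_sumr -big_split.
apply: eq_bigr => V _ /=; rewrite scalerA mulrC -scalerA -scalerDr; congr (_ *: _).
exact: (glift_lin (mulf_iso V) (mulf_plus V)).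
Qed.

Let mul0l y : green_mul 0 y = 0.
Proof.
by have := green_mul_linl (-1) 0 0 y; rewrite scaler0 addr0 scaleN1r addNr.
Qed.

Let mul0r x : green_mul x 0 = 0.
Proof.
by have := green_mul_linr (-1) x 0 0; rewrite scaler0 addr0 scaleN1r addNr.
Qed.

Fact green_mulA : associative green_mul.
Proof.
move=> x y z; elim/green_span: x => [U| |c x x' Ex Ex'].
- elim/green_span: y => [V| |c y y' Ey Ey'].
  + elim/green_span: z => [W| |c z z' Ez Ez'].
    * by rewrite !gclassM; apply/gclass_iso/tmulA.
    * by rewrite !mul0r.
    * by rewrite !green_mul_linr Ez Ez'.
  + by rewrite mul0r !mul0l mul0r.
  + by rewrite green_mul_linl !green_mul_linr green_mul_linl Ey Ey'.
- by rewrite !mul0l.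
- by rewrite !green_mul_linl Ex Ex'.
Qed.

Fact green_mul1l : left_id (gclass (tunit n hq)) green_mul.
Proof.
elim/green_span=> [V| |c x y Ex Ey]; last by rewrite green_mul_linr Ex Ey.
  by rewrite gclassM; apply/esym/gclass_iso/tmul1V.
exact: mul0r.
Qed.

Fact green_mul1r : right_id (gclass (tunit n hq)) green_mul.
Proof.
elim/green_span=> [V| |c x y Ex Ey]; last by rewrite green_mul_linl Ex Ey.
  by rewrite gclassM; apply/esym/gclass_iso/tmulV1.
exact: mul0l.
Qed.

Fact green_mulDl : left_distributive green_mul +%R.
Proof. by move=> x y z; have := green_mul_linl 1 x y z; rewrite !scale1r. Qed.

Fact green_mulDr : right_distributive green_mul +%R.
Proof. by move=> x y z; have := green_mul_linr 1 x y z; rewrite !scale1r. Qed.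

Fact green_nz : gclass (tunit n hq) != 0.
Proof.
pose f V : k^o := (tdim V)%:R.
have f_iso V W : tiso V W -> f V = f W by move=> /tiso_dim; rewrite /f => ->.
have f_plus V W : f (tplus V W) = f V + f W by rewrite /f natrD.
apply/eqP => /(congr1 (glift f)).
rewrite (glift_class f_iso f_plus).
have := glift_lin f_iso f_plus (-1) 0 0.
rewrite scaler0 addr0 scaleN1r addNr => -> /eqP; rewrite /f /=.
by rewrite oner_eq0.
Qed.

HB.instance Definition _ := GRing.Zmodule_isNzRing.Build green
  green_mulA green_mul1l green_mul1r green_mulDl green_mulDr green_nz.

Fact green_scaleAl c (x y : green) : c *: (x * y) = (c *: x) * y.
Proof.
by rewrite -[c *: x]addr0 [RHS]green_mul_linl mul0l addr0.
Qed.

HB.instance Definition _ := GRing.Lmodule_isLalgebra.Build k green green_scaleAl.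

Fact green_scaleAr c (x y : green) : c *: (x * y) = x * (c *: y).
Proof.
by rewrite -[c *: y]addr0 [RHS]green_mul_linr mul0r addr0.
Qed.

HB.instance Definition _ := GRing.Lalgebra_isAlgebra.Build k green green_scaleAr.

End GreenAlgebra.
Local Open Scope complex_scope.

(* M(l, i): in the basis v_0, ..., v_{l-1}, g is diagonal with entries
   omega^i q^{-j} and h shifts v_j to v_{j+1}. The index i, an integer modulo n
   since omega^n = 1, is given by a representative in int. *)
Section TaftIndecomposable.
Variables (K : fieldType) (n d : nat) (q omega : K).
Hypothesis hdn : (d %| n)%N.
Hypothesis hq : d.-primitive_root q.
Hypothesis hw : n.-primitive_root omega.
Variable l : nat.
Hypothesis hl : (l <= d)%N.
Variable i : int.

Definition taftM_g : 'M[K]_l := diag_mx (\row_j (omega ^ i * q ^- j)).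
Definition taftM_h : 'M[K]_l := \matrix_(a, b) (a == b.+1 :> nat)%:R.

Fact taftM_gX : taftM_g ^+ n = 1%:M.
Proof.
have E k : taftM_g ^+ k = diag_mx (\row_j ((omega ^ i * q ^- j) ^+ k)).
  elim: k => [|k IHk]; first by apply/matrixP=> a b; rewrite !mxE.
  rewrite exprS IHk -[LHS]/(_ *m _) mulmx_diag; congr diag_mx.
  by apply/rowP=> a; rewrite !mxE exprS.
rewrite {}E -diag_const_mx; congr diag_mx; apply/rowP=> j; rewrite !mxE exprMn.
rewrite exprnP -exprzAC -exprnP (prim_expr_order hw) exp1rz mul1r.
rewrite exprVn -exprM mulnC exprM.
by have /eqP-> : q ^+ n == 1; [rewrite -(prim_order_dvd hq) | rewrite expr1n invr1].
Qed.

Fact taftM_hX : taftM_h ^+ d = 0.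
Proof.
have E k : taftM_h ^+ k = \matrix_(a, b) (a == b + k :> nat)%N%:R.
  elim: k => [|k IHk]; first by apply/matrixP=> a b; rewrite !mxE addn0.
  rewrite exprS IHk -[LHS]/(_ *m _); apply/matrixP=> a b; rewrite !mxE.
  have [lt_bk_l | le_l_bk] := ltnP (b + k) l.
    rewrite (bigD1 (Ordinal lt_bk_l)) //= !mxE /= eqxx mulr1 -addnS big1 ?addr0 // => c ne_c.
    have bk_c : (c == b + k :> nat)%N = false by apply/negbTE.
    by rewrite !mxE bk_c mulr0.
  rewrite big1 => [|c _]; last first.
    by rewrite !mxE (ltn_eqF (leq_trans (ltn_ord c) le_l_bk)) mulr0.
  by rewrite ltn_eqF // addnS ltnW // ltnS (leq_trans (ltn_ord a)).
rewrite E; apply/matrixP=> a b; rewrite !mxE ltn_eqF //.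
by rewrite (leq_trans (ltn_ord a)) // (leq_trans hl) // leq_addl.
Qed.

Fact taftM_hg : taftM_h *m taftM_g = q *: (taftM_g *m taftM_h).
Proof.
have q_nz : q != 0 by rewrite (prim_root_eq0 hq) -lt0n (prim_order_gt0 hq).
rewrite mul_mx_diag mul_diag_mx; apply/matrixP=> a b; rewrite !mxE.
have [->|] := eqVneq (a : nat) b.+1; last by rewrite mul0r !mulr0.
by rewrite mul1r mulr1 mulrCA exprS invfM mulVKf.
Qed.

Definition taftM : taftMod n d q := TaftMod taftM_gX taftM_hX taftM_hg.

End TaftIndecomposable.

(* Finite dimensional left modules over an algebra A over a field F. *)
Record fdModule (F : fieldType) (A : algType F) := FdModule {
  carrier :> vectType F;
  mod_act : {linear A -> 'End(carrier)};
  mod_act1 : mod_act 1 = \1%VF;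
  mod_actM : forall a b, mod_act (a * b) = (mod_act a \o mod_act b)%VF }.

Section FdModule.
Variables (F : fieldType) (A : algType F) (V : fdModule A).

Definition submodule (U : {vspace V}) : Prop :=
  forall a : A, (mod_act V a @: U <= U)%VS.

Definition irreducible : Prop :=
  fullv != 0%VS :> {vspace V} /\
  forall U : {vspace V}, submodule U -> U = 0%VS \/ U = fullv.

Definition indecomposable : Prop :=
  fullv != 0%VS :> {vspace V} /\
  forall U W : {vspace V}, submodule U -> submodule W ->
    (U + W)%VS = fullv -> (U :&: W)%VS = 0%VS -> U = 0%VS \/ W = 0%VS.

End FdModule.

Section VkModule.
Variables (R : realType) (K : fieldType) (n d : nat) (q omega : K).
Hypothesis hd : (2 <= d)%N.
Hypothesis hdn : (d %| n)%N.
Hypothesis hq : d.-primitive_root q.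
Hypothesis hw : n.-primitive_root omega.

Definition GreenC : algType R[i] := greenAlg R[i] n hq.

Definition green_y : GreenC := gclass R[i] hq (taftM hdn hq hw (ltnW hd) (-1)).
Definition green_z : GreenC := gclass R[i] hq (taftM hdn hq hw hd 0).

Definition omegaC (k : nat) : R[i] :=
  (cos (2 * k%:R * pi / n%:R) +i* sin (2 * k%:R * pi / n%:R))%C.

(* V is isomorphic to V(k): some C-basis v1, v2 of V has the action of y and z
   by which V(k) is given. *)
Definition iso_Vk (V : fdModule GreenC) (k : nat) : Prop :=
  exists v1 v2 : V,
    [/\ basis_of fullv [:: v1; v2],
        mod_act V green_y v1 = omegaC k *: v1,
        mod_act V green_y v2 = omegaC k *: v2,
        mod_act V green_z v1 = (1 + omegaC k ^+ (n %/ d)) *: v1 &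
        mod_act V green_z v2 = v1 + (1 + omegaC k ^+ (n %/ d)) *: v2].

End VkModule.

(* Main.v *)
(* The modules M(l, i) split off every H_{n,d}-module: if h^l = 0 and
   h^{l-1} <> 0, the projections onto the g-eigenspaces give a g-eigenvector v
   and a g-eigenform phi with phi(h^{l-1} v) = 1, and v spans a cyclic summand
   complemented by the common kernel of the forms phi o h^j. Together with the
   rules for M(2,0) (x) M(l,i), proved by exhibiting such pairs (v, phi), this
   shows that y and z generate the Green algebra, that it is commutative, and
   that (z - y^m - 1) F_d(y^m, z) = 0.
   On an indecomposable module y is therefore a scalar omega_k and, with
   a = omega_k^m, z is killed by (X - (1 + a)) F_d(a, X), where F_d(a, X) has
   d - 1 distinct roots. So z is a scalar, and then the module is irreducible,
   or 1 + a is a root of F_d(a, X) and (z - (1 + a))^2 = 0. The latter forces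
   d not to divide k, because F_d(1, 2) = d, and a nonzero Jordan block of size
   2 is a direct summand. *)
Require Import Defs.
From mathcomp Require Import all_boot all_order all_algebra.
From mathcomp Require Import boolp reals trigo ring lra.
From mathcomp.real_closed Require Import complex mxtens.

Set Implicit Arguments.
Unset Strict Implicit.
Unset Printing Implicit Defensive.

Import Order.TTheory GRing.Theory Num.Theory.
Local Open Scope ring_scope.

Lemma mulmx1C_eqdim (K : comNzRingType) m n (A : 'M[K]_(m, n)) (B : 'M_(n, m)) :
  m = n -> A *m B = 1%:M -> B *m A = 1%:M.
Proof. by move=> e; case: n / e A B => A B; apply: mulmx1C. Qed.

Lemma exprZmx (K : comNzRingType) N (c : K) (A : 'M_N) k :
  (c *: A) ^+ k = c ^+ k *: A ^+ k.
Proof.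
elim: k => [|k IHk]; first by rewrite !expr0 scale1r.
by rewrite !exprS IHk -[LHS]/(_ *m _) -scalemxAl -scalemxAr scalerA.
Qed.

(** * Morphisms between M(l, i) and a module, from vectors and forms *)

Section Chains.
Variables (K : fieldType) (n d : nat) (q omega : K).
Hypothesis hq : d.-primitive_root q.
Local Notation tmod := (taftMod n d q).
Implicit Types V W : tmod.

Let q_neq0 : q != 0.
Proof. by rewrite (prim_root_eq0 hq) -lt0n (prim_order_gt0 hq). Qed.

(** The [Q]s need not be morphisms: they only provide a left inverse of [row_mx P1 P2], which is
    two-sided because the dimensions agree. *)
Lemma tiso_plus V V1 V2 (P1 : 'M_(tdim V, tdim V1)) (P2 : 'M_(tdim V, tdim V2))
    (Q1 : 'M_(tdim V1, tdim V)) (Q2 : 'M_(tdim V2, tdim V)) :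
    (tdim V1 + tdim V2)%N = tdim V ->
    P1 *m tg V1 = tg V *m P1 -> P1 *m th V1 = th V *m P1 ->
    P2 *m tg V2 = tg V *m P2 -> P2 *m th V2 = th V *m P2 ->
    Q1 *m P1 = 1%:M -> Q1 *m P2 = 0 -> Q2 *m P1 = 0 -> Q2 *m P2 = 1%:M ->
  tiso (tplus V1 V2) V.
Proof.
move=> dimV g1 h1 g2 h2 Q11 Q12 Q21 Q22.
pose P : 'M_(tdim V, tdim V1 + tdim V2) := row_mx P1 P2.
pose Q : 'M_(tdim V1 + tdim V2, tdim V) := col_mx Q1 Q2.
have QP : Q *m P = 1%:M.
  by rewrite mul_col_row Q11 Q12 Q21 Q22 -scalar_mx_block.
exists P, Q; split=> //=; first exact: mulmx1C_eqdim QP.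
- by rewrite mul_row_block !mulmx0 addr0 add0r mul_mx_row g1 g2.
- by rewrite mul_row_block !mulmx0 addr0 add0r mul_mx_row h1 h2.
Qed.

Lemma thXg V s : th V ^+ s *m tg V = q ^+ s *: (tg V *m th V ^+ s).
Proof.
elim: s => [|s IHs]; first by rewrite !expr0 scale1r mul1mx mulmx1.
rewrite [th V ^+ _]exprS -[_ * _]/(_ *m _) -mulmxA IHs -scalemxAr.
by rewrite [th V *m (_ *m _)]mulmxA thg -scalemxAl scalerA -exprSr mulmxA.
Qed.

Lemma tgXh V s : tg V *m th V ^+ s = q ^- s *: (th V ^+ s *m tg V).
Proof. by rewrite thXg scalerA mulVf ?scale1r // expf_neq0. Qed.

(* For [h ^ l v = 0] and [v] of weight [omega ^ i], [chain l v] is the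
   morphism from [M(l, i)] with [v_j |-> h ^ j v]; dually, [cochain l phi] is the
   morphism to [M(l, i)] with coordinates [phi (h ^ (l - 1 - j) x)]. *)
Definition chain V l (v : 'cV[K]_(tdim V)) : 'M[K]_(tdim V, l) :=
  \matrix_(a, j) (th V ^+ j *m v) a 0.

Definition cochain V l (phi : 'rV[K]_(tdim V)) : 'M[K]_(l, tdim V) :=
  \matrix_(j, a) (phi *m th V ^+ (l.-1 - j)) 0 a.

Lemma col_chain V l v j : col j (@chain V l v) = th V ^+ j *m v.
Proof. by apply/colP=> a; rewrite !mxE. Qed.

Lemma row_cochain V l phi j :
  row j (@cochain V l phi) = phi *m th V ^+ (l.-1 - j).
Proof. by apply/rowP=> a; rewrite !mxE. Qed.

Lemma chain_g V l v i : tg V *m v = omega ^ i *: v ->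
  chain l v *m taftM_g q omega l i = tg V *m chain l v.
Proof.
move=> gv; apply/matrixP=> a j; rewrite mul_mx_diag mxE [RHS]mxE.
transitivity ((tg V *m col j (chain l v)) a 0).
  rewrite col_chain mulmxA tgXh -scalemxAl -mulmxA gv -scalemxAr scalerA.
  by rewrite !mxE mulrC [omega ^ i * _]mulrC.
by rewrite mxE; apply: eq_bigr => b _; rewrite [in LHS]mxE.
Qed.

Lemma chain_h V l v : th V ^+ l *m v = 0 ->
  chain l v *m taftM_h K l = th V *m chain l v.
Proof.
move=> hv; apply/matrixP=> a j; rewrite [RHS]mxE.
transitivity ((th V *m col j (chain l v)) a 0); last first.
  by rewrite mxE; apply: eq_bigr => b _; rewrite [in LHS]mxE.
rewrite col_chain mulmxA -[th V *m _ ^+ j]/(th V * _ ^+ j) -exprS mxE.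
have [lt_jl | le_lj] := ltnP j.+1 l.
  rewrite (bigD1 (Ordinal lt_jl)) //= big1 ?addr0; first by rewrite !mxE eqxx mulr1.
  by move=> b ne_b; rewrite !mxE (_ : (b == j.+1 :> nat)%N = false) ?mulr0 //;
    apply/negbTE.
have ej : j.+1 = l by apply/eqP; rewrite eqn_leq le_lj ltn_ord.
rewrite ej hv mxE big1 // => b _.
by rewrite !mxE ej ltn_eqF ?mulr0 // ltn_ord.
Qed.

(** [mu] is the weight of [h ^ (l - 1) v] when [v] has weight [omega ^ i]; a [g]-eigenform that does
    not vanish on that vector must have this eigenvalue. *)
Lemma cochain_g V l phi mu i : phi *m tg V = mu *: phi ->
    mu = q ^- l.-1 * omega ^ i ->
  taftM_g q omega l i *m cochain l phi = cochain l phi *m tg V.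
Proof.
move=> phig mu_eq; apply/matrixP=> j a; rewrite mul_diag_mx mxE [RHS]mxE.
transitivity ((row j (cochain l phi) *m tg V) 0 a); last first.
  by rewrite mxE; apply: eq_bigr => b _; rewrite [in LHS]mxE.
have le_jl : (j <= l.-1)%N by rewrite -ltnS prednK // (leq_ltn_trans _ (ltn_ord j)).
rewrite row_cochain -mulmxA thXg -scalemxAr mulmxA phig -scalemxAl scalerA.
rewrite mu_eq mulrA !mxE; congr (_ * _).
rewrite mulrC; congr (_ * _).
rewrite -[X in _ = _ / q ^+ X](subnK le_jl); set s := (_ - _)%N.
by rewrite exprD invfM mulVKf // expf_neq0.
Qed.

Lemma cochain_h V l (phi : 'rV_(tdim V)) : phi *m th V ^+ l = 0 ->
  taftM_h K l *m cochain l phi = cochain l phi *m th V.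
Proof.
move=> phih; apply/matrixP=> j a; rewrite [RHS]mxE.
transitivity ((row j (cochain l phi) *m th V) 0 a); last first.
  by rewrite mxE; apply: eq_bigr => b _; rewrite [in LHS]mxE.
rewrite row_cochain -mulmxA -[_ *m th V]/(_ * th V) -exprSr mxE.
case: j => -[|j] lt_jl /=.
  rewrite subn0 prednK // phih mxE big1 // => b _.
  by rewrite !mxE mul0r.
rewrite (bigD1 (Ordinal (ltnW lt_jl))) //= big1 ?addr0 => [|b ne_b].
  by rewrite !mxE eqxx mul1r -subSn ?subSS // -ltnS prednK // (leq_ltn_trans _ lt_jl).
rewrite !mxE eqSS (_ : (j == b :> nat)%N = false) ?mul0r //.
by apply/negbTE; rewrite eq_sym.
Qed.

Lemma cochainE V W l l' (phi : 'rV_(tdim V)) v a b :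
  (cochain l phi *m chain l' v) a b = (phi *m th V ^+ (l.-1 - a + b) *m v) 0 0.
Proof.
transitivity ((row a (cochain l phi) *m col b (chain l' v)) 0 0).
  by rewrite !mxE; apply: eq_bigr => c _; rewrite [in RHS]mxE [(col _ _) c 0]mxE.
by rewrite row_cochain col_chain exprD mulmxA -[_ * _ ^+ b]/(_ *m _) mulmxA.
Qed.

Lemma cochain_chain0 V l l' (phi : 'rV_(tdim V)) v :
    (forall s, phi *m th V ^+ s *m v = 0) ->
  cochain l phi *m chain l' v = 0.
Proof. by move=> E; apply/matrixP=> a b; rewrite cochainE // E !mxE. Qed.

Lemma cochain_chain1 V l (phi : 'rV_(tdim V)) v :
    (forall s, phi *m th V ^+ s *m v = (s.+1 == l)%:R%:M) ->
  cochain l phi *m chain l v = 1%:M.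
Proof.
move=> E; apply/matrixP=> a b; rewrite cochainE // E !mxE eqxx mulr1n.
congr (_%:R); case: l a b E => [[]|l] a b _ //.
by rewrite eqSS -val_eqE /= -(eqn_add2r a) addnAC subnK // ?leq_ord // eqn_add2l eq_sym.
Qed.

End Chains.

(** * Splitting off a cyclic summand M(l, i) *)

Section Splitting.
Variables (K : fieldType) (n d : nat) (q omega : K).
Hypotheses (hdn : (d %| n)%N) (hq : d.-primitive_root q) (hw : n.-primitive_root omega).
Local Notation tmod := (taftMod n d q).
Local Notation M hl i := (taftM hdn hq hw hl i).
Implicit Types V W : tmod.

(** The complement is the image of the idempotent [E = 1 - P Q], which commutes with the action. A
    rank factorization [E = B C] gives it coordinates, in which [X] acts as [C X B]. *)
Lemma tiso_split V V1 (P : 'M_(tdim V, tdim V1)) (Q : 'M_(tdim V1, tdim V)) :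
    P *m tg V1 = tg V *m P -> P *m th V1 = th V *m P ->
    tg V1 *m Q = Q *m tg V -> th V1 *m Q = Q *m th V ->
    Q *m P = 1%:M ->
  exists W, tiso (tplus V1 W) V.
Proof.
move=> Pg Ph Qg Qh QP; pose E := 1%:M - P *m Q.
have [r [B [C [BC fullB freeC]]]] : exists r (B : 'M_(_, r)) (C : 'M_(r, _)),
    [/\ B *m C = E, row_full B & row_free C].
  exists (\rank E), (col_base E), (row_base E).
  by rewrite mulmx_base col_base_full row_base_free.
have QE : Q *m E = 0 by rewrite mulmxBr mulmx1 mulmxA QP mul1mx subrr.
have EP : E *m P = 0 by rewrite mulmxBl mul1mx -mulmxA QP mulmx1 subrr.
have QB : Q *m B = 0.
  by apply: (row_free_inj freeC); rewrite mul0mx -mulmxA BC.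
have CP : C *m P = 0.
  by apply: (row_full_inj fullB); rewrite mulmx0 mulmxA BC.
have BCB : B *m C *m B = B by rewrite BC mulmxBl mul1mx -mulmxA QB mulmx0 subr0.
have CB : C *m B = 1%:M.
  by apply: (row_full_inj fullB); rewrite mulmx1 mulmxA BCB.
have PQBC : P *m Q + B *m C = 1%:M by rewrite BC addrC subrK.
have commE X Y : P *m Y = X *m P -> Y *m Q = Q *m X -> E *m X = X *m E.
  by move=> PX QX; rewrite mulmxBl mulmxBr mul1mx mulmx1 mulmxA -PX -!mulmxA QX.
have Eg := commE _ _ Pg Qg; have Eh := commE _ _ Ph Qh.
have ECB X : E *m X = X *m E -> B *m (C *m X *m B) = X *m B.
  by move=> EX; rewrite !mulmxA BC EX -mulmxA -BC -mulmxA CB mulmx1.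
have CXB X Y : E *m Y = Y *m E ->
    (C *m X *m B) *m (C *m Y *m B) = C *m (X *m Y) *m B.
  by move=> EY; rewrite -[C *m X *m B *m _]mulmxA ECB // !mulmxA.
have EX X k : E *m X = X *m E -> E *m X ^+ k = X ^+ k *m E.
  by move=> cEX; apply: commrX.
have CXBX X k : E *m X = X *m E -> (C *m X *m B) ^+ k = C *m X ^+ k *m B.
  move=> cEX; elim: k => [|k IHk]; first by rewrite !expr0 mulmx1.
  by rewrite !exprS -[LHS]/(_ *m _) IHk CXB //; apply: EX.
have Wg : (C *m tg V *m B) ^+ n = 1%:M by rewrite CXBX // tgX mulmx1.
have Wh : (C *m th V *m B) ^+ d = 0 by rewrite CXBX // thX mulmx0 mul0mx.
have Whg : C *m th V *m B *m (C *m tg V *m B) =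
    q *: (C *m tg V *m B *m (C *m th V *m B)).
  by rewrite !CXB // thg -scalemxAr -scalemxAl.
exists (TaftMod Wg Wh Whg).
apply: (@tiso_plus _ _ _ _ _ _ (TaftMod Wg Wh Whg) P B Q C) => //=.
- apply/anti_leq/andP; split.
    apply: (@mulmx1_min _ _ _ (col_mx Q C) (row_mx P B)).
    by rewrite mul_col_row QP QB CP CB -scalar_mx_block.
  apply: (@mulmx1_min _ _ _ (row_mx P B) (col_mx Q C)).
  by rewrite mul_row_col.
- exact: ECB.
- exact: ECB.
Qed.

(** With [X = c *: tg V], the geometric sum satisfies [(X - 1) e = X ^ n - 1 = 0]. Up to the factor
    [n], [e] is the projection onto the [g]-eigenspace for [c^-1]. *)
Lemma tg_projection V (c : K) : c ^+ n = 1 ->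
  let e := \sum_(j < n) (c *: tg V) ^+ j in
  tg V *m e = c^-1 *: e /\ e *m tg V = c^-1 *: e.
Proof.
move=> cn e.
have n_gt0 := prim_order_gt0 hw.
have c0 : c != 0 by apply: contra_eq_neq cn => ->;
  rewrite expr0n gtn_eqF // eq_sym oner_eq0.
pose X := c *: tg V; have Xn : X ^+ n = 1%:M by rewrite exprZmx cn tgX scale1r.
have Xe : X *m e = e.
  apply/eqP; rewrite -subr_eq0 -[X in _ - X]mul1mx -mulmxBl; apply/eqP.
  by rewrite -[_ *m _]/((X - 1) * e) -subrX1 Xn subrr.
have eX : e *m X = e by rewrite -[RHS]Xe; apply/esym/commr_sum=> j _; apply: commrX.
split; first by rewrite -[in RHS]Xe -scalemxAl scalerA mulVf ?scale1r.
by rewrite -[in RHS]eX -scalemxAr scalerA mulVf ?scale1r.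
Qed.

(** Orthogonality of characters: for [0 < j < n] the powers [omega ^ (k j)] sum to 0 over [k], so
    only the terms with [j = 0] survive. *)
Lemma sum_tg_projection V :
  \sum_(k < n) \sum_(j < n) ((omega ^+ k) *: tg V) ^+ j = n%:R%:M.
Proof.
rewrite exchange_big /=.
have n_gt0 := prim_order_gt0 hw.
rewrite (bigD1 (Ordinal n_gt0)) //= [X in _ + X]big1 ?addr0 => [|j j_neq0].
  by under eq_bigr do rewrite expr0; rewrite sumr_const card_ord -[1]/1%:M -raddfMn.
under eq_bigr => k _ do rewrite exprZmx exprAC.
rewrite -scaler_suml; set s := \sum_(k < n) _.
have /eqP : (omega ^+ j - 1) * s = 0.
  by rewrite -subrX1 exprAC (prim_expr_order hw) expr1n subrr.
rewrite mulf_eq0 subr_eq0 -(prim_order_dvd hw) => /orP[|/eqP ->]; last by rewrite scale0r.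
rewrite gtnNdvd ?lt0n //.
Qed.

Lemma taft_split V : n%:R != 0 :> K -> (0 < tdim V)%N ->
  exists l (hl : (l <= d)%N) k W,
    (0 < l)%N /\ tiso (tplus (M hl (- k%:Z)) W) V.
Proof.
move=> n_neq0 V_gt0.
have one_neq0 : (1%:M : 'M[K]_(tdim V)) != 0.
  by apply: contraTneq V_gt0 => /(congr1 (@mxrank K _ _)); rewrite mxrank1 mxrank0 => ->.
have exh : exists l, th V ^+ l == 0 by exists d; rewrite thX.
case: (ex_minnP exh) => l /eqP hl0 lmin.
have hl : (l <= d)%N by apply: lmin; rewrite thX.
have l_gt0 : (0 < l)%N by rewrite lt0n; apply: contra_eq_neq hl0 => ->.
pose e k : 'M_(tdim V) := \sum_(j < n) ((omega ^+ k) *: tg V) ^+ j.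
have eg k : tg V *m e k = omega ^- k *: e k /\ e k *m tg V = omega ^- k *: e k.
  by apply: tg_projection; rewrite exprAC (prim_expr_order hw) expr1n.
(* The [e i] sum to the nonzero scalar [n], and [h ^ (l - 1)] is nonzero by minimality of [l], so
   some block between two eigenspaces is nonzero. A nonzero entry [(a, b)] of it selects [v] and
   [phi]. *)
have [[i k] /= /matrix0Pn[a [b ab]]] :
    exists ik : 'I_n * 'I_n, e ik.1 *m th V ^+ l.-1 *m e ik.2 != 0.
  apply/existsP; apply: contraT; rewrite negb_exists => /forallP /= all0.
  have: (\sum_(i < n) e i) *m th V ^+ l.-1 *m (\sum_(k < n) e k) == 0.
    rewrite !mulmx_suml big1 // => i _; rewrite mulmx_sumr big1 // => k _.
    by apply/eqP; move: (all0 (i, k)); rewrite negbK.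
  rewrite sum_tg_projection mul_scalar_mx mul_mx_scalar !scaler_eq0.
  by rewrite (negPf n_neq0) /= => /lmin; rewrite leqNgt prednK ?leqnn.
pose c := (e i *m th V ^+ l.-1 *m e k) a b.
pose v := col b (e k); pose phi := c^-1 *: row a (e i).
have gv : tg V *m v = omega ^- k *: v.
  by rewrite /v !colE mulmxA (eg k).1 -scalemxAl.
have phig : phi *m tg V = omega ^- i *: phi.
  rewrite -scalemxAl scalerA mulrC -scalerA; congr (_ *: _).
  by rewrite !rowE -mulmxA (eg i).2 -scalemxAr.
have phiv1 : phi *m th V ^+ l.-1 *m v = 1%:M.
  apply/matrixP=> x y; rewrite !ord1 -scalemxAl -scalemxAl mxE.
  by rewrite -!row_mul /v colE mulmxA -colE mxE [col _ _ _ _]mxE mulVf // mxE eqxx mulr1n.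
(* Evaluate [phi g h^s v] in two ways: [g] acts on [phi], or moves past [h ^ s] and acts on [v]. *)
have phiv s : omega ^- i *: (phi *m th V ^+ s *m v) =
              (q ^- s * omega ^- k) *: (phi *m th V ^+ s *m v).
  rewrite scalemxAl scalemxAl -phig -[phi *m tg V *m _]mulmxA (tgXh hq).
  by rewrite -scalemxAr -scalemxAl -!mulmxA gv -!scalemxAr scalerA.
have mu_eq : omega ^- i = q ^- l.-1 * omega ^- k.
  have/(congr1 (fun x : 'M_1 => x 0 0)) := phiv l.-1.
  by rewrite phiv1 !mxE eqxx !mulr1n !mulr1.
(* For [s < l] other than [l - 1] the two weights differ, since [l <= d] and [q] has order [d], so
   the pairing vanishes. *)
have phivE s : phi *m th V ^+ s *m v = (s.+1 == l)%:R%:M.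
  have [e_sl|ne_sl] := eqVneq s.+1 l; first by rewrite -phiv1 -e_sl.
  rewrite raddf0; have [le_ls|lt_sl] := leqP l s.
    by rewrite -(subnKC le_ls) exprD hl0 mul0r mulmx0 mul0mx.
  have/eqP := phiv s; rewrite -subr_eq0 -scalerBl scaler_eq0 => /orP[|/eqP //].
  rewrite mu_eq -mulrBl mulf_eq0 orbC.
  rewrite invr_eq0 expf_eq0 (prim_root_eq0 hw) gtn_eqF ?(prim_order_gt0 hw) ?andbF //=.
  rewrite subr_eq0 (inj_eq invr_inj) (eq_prim_root_expr hq) !modn_small.
  - by rewrite -(inj_eq succn_inj) prednK // eq_sym (negPf ne_sl).
  - by apply: leq_trans hl.
  - by rewrite prednK.
have hv : th V ^+ l *m v = 0 by rewrite hl0 mul0mx.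
have [W VW] : exists W, tiso (tplus (M hl (- k%:Z)) W) V.
  apply: (@tiso_split V (M hl (- k%:Z)) (chain l v) (cochain l phi)) => /=.
  - by apply: chain_g => //; rewrite gv exprnN.
  - exact: chain_h.
  - by apply: (cochain_g hq phig); rewrite mu_eq -exprnN.
  - by apply: cochain_h; rewrite hl0 mulmx0.
  - exact: cochain_chain1.
by exists l, hl, k, W.
Qed.

End Splitting.

Local Notation "A *t B" := (tensmx A B)
  (at level 40, left associativity, format "A  *t  B").

(** * Standard vectors indexed by natural numbers *)

Section NatBasis.
Variable K : fieldType.

(* The standard column and row vectors, with the value 0 out of range. *)
Definition cbase l b : 'cV[K]_l := \col_j (j == b :> nat)%:R.
Definition rbase l b : 'rV[K]_l := \row_j (j == b :> nat)%:R.

Lemma cbase_ge l b : (l <= b)%N -> cbase l b = 0.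
Proof. by move=> le_lb; apply/colP=> j; rewrite !mxE ltn_eqF // (leq_trans _ le_lb). Qed.

Lemma rbase_cbase l a b : rbase l a *m cbase l b = ((a == b) && (a < l)%N)%:R%:M.
Proof.
apply/matrixP=> x y; rewrite !ord1 !mxE eqxx mulr1n.
have [lt_al | le_la] := ltnP a l.
  rewrite (bigD1 (Ordinal lt_al)) //= !mxE /= eqxx mul1r big1 ?addr0 ?andbT // => j ne_ja.
  by rewrite !mxE (_ : (j == a :> nat)%N = false) ?mul0r //; apply/negbTE.
by rewrite andbF big1 // => j _; rewrite !mxE ltn_eqF ?mul0r // (leq_trans _ le_la).
Qed.

Lemma taftM_h_cbase l b : taftM_h K l *m cbase l b = cbase l b.+1.
Proof.
have [lt_bl | le_lb] := ltnP b l; last by rewrite !cbase_ge ?mulmx0 // ltnW.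
apply/colP=> j; rewrite !mxE (bigD1 (Ordinal lt_bl)) //= !mxE /= eqxx mulr1.
rewrite big1 ?addr0 // => c ne_cb.
by rewrite !mxE (_ : (c == b :> nat)%N = false) ?mulr0 //; apply/negbTE.
Qed.

Lemma taftM_g_cbase (q omega : K) l i b :
  taftM_g q omega l i *m cbase l b = (omega ^ i * q ^- b) *: cbase l b.
Proof.
rewrite mul_diag_mx; apply/colP=> j; rewrite !mxE.
by have [->|] := eqVneq (j : nat) b; rewrite ?mulr0.
Qed.

End NatBasis.

(* [tensmx_mul] at width 1, where [1 * 1] has to be identified with [1]. *)
Lemma tensmx_mulc (K : comNzRingType) m p (A : 'M[K]_m) (B : 'M_p)
    (x : 'cV_m) (y : 'cV_p) :
  (A *t B) *m (x *t y : 'cV_(m * p)) = ((A *m x) *t (B *m y) : 'cV_(m * p)).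
Proof. exact: (tensmx_mul A B x y). Qed.

Lemma tensmx_mulrc (K : comNzRingType) m p (u : 'rV[K]_m) (w : 'rV_p)
    (x : 'cV_m) (y : 'cV_p) :
  (u *t w : 'rV_(m * p)) *m (x *t y : 'cV_(m * p)) = ((u *m x) *t (w *m y) : 'M_1).
Proof. exact: (tensmx_mul u w x y). Qed.

(** * Decomposition of M(2,0) tensor M(l,i) *)

Section Tensor.
Variables (K : fieldType) (n d : nat) (q omega : K).
Hypotheses (hd : (2 <= d)%N) (hdn : (d %| n)%N) (hq : d.-primitive_root q).
Hypothesis hw : n.-primitive_root omega.
Local Notation tmod := (taftMod n d q).
Local Notation M hl i := (taftM hdn hq hw hl i).
Implicit Types V W : tmod.

Lemma tiso_cyclic2 V l1 l2 (hl1 : (l1 <= d)%N) (hl2 : (l2 <= d)%N) i1 i2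
    (v1 v2 : 'cV_(tdim V)) (phi1 phi2 : 'rV_(tdim V)) :
    (l1 + l2)%N = tdim V ->
    tg V *m v1 = omega ^ i1 *: v1 -> th V ^+ l1 *m v1 = 0 ->
    tg V *m v2 = omega ^ i2 *: v2 -> th V ^+ l2 *m v2 = 0 ->
    (forall s, phi1 *m th V ^+ s *m v1 = (s.+1 == l1)%:R%:M) ->
    (forall s, phi1 *m th V ^+ s *m v2 = 0) ->
    (forall s, phi2 *m th V ^+ s *m v1 = 0) ->
    (forall s, phi2 *m th V ^+ s *m v2 = (s.+1 == l2)%:R%:M) ->
  tiso (tplus (M hl1 i1) (M hl2 i2)) V.
Proof.
move=> dimV g1 h1 g2 h2 E11 E12 E21 E22.
apply: (@tiso_plus _ _ _ _ V (M hl1 i1) (M hl2 i2) (chain l1 v1) (chain l2 v2)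
  (cochain l1 phi1) (cochain l2 phi2)) => //=.
- exact: chain_g.
- exact: chain_h.
- exact: chain_g.
- exact: chain_h.
- exact: cochain_chain1.
- exact: cochain_chain0.
- exact: cochain_chain0.
- exact: cochain_chain1.
Qed.

(** The q-integer of [s] at [q^-1]; it is nonzero for [0 < s < d] and vanishes at [d], which
    separates the cases [l < d] and [l = d] below. *)
Definition qsum s : K := \sum_(j < s) q ^- j.

Lemma qsum0 : qsum 0 = 0.
Proof. exact: big_ord0. Qed.

Lemma qsumE s : (1 - q^-1) * qsum s = 1 - q ^- s.
Proof.
rewrite /qsum; under eq_bigr do rewrite -exprVn.
by rewrite -opprB mulNr -subrX1 opprB exprVn.
Qed.

Lemma qsumS s : qsum s.+1 = 1 + q^-1 * qsum s.
Proof.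
rewrite /qsum big_ord_recl expr0 invr1 mulr_sumr; congr (_ + _).
by apply: eq_bigr => j _; rewrite exprS invfM.
Qed.

Lemma qsumSr s : qsum s.+1 = qsum s + q ^- s.
Proof. exact: big_ord_recr. Qed.

Let q1_neq0 : 1 - q^-1 != 0.
Proof.
rewrite subr_eq0 eq_sym invr_eq1 -[q]expr1 -(prim_order_dvd hq).
by rewrite gtnNdvd.
Qed.

Lemma qsum_neq0 s : (0 < s < d)%N -> qsum s != 0.
Proof.
case/andP=> s_gt0 lt_sd; apply: contraTneq isT => s0.
have /eqP := qsumE s; rewrite s0 mulr0 eq_sym subr_eq0 eq_sym invr_eq1.
by rewrite -(prim_order_dvd hq) gtnNdvd.
Qed.

Lemma qsumd : qsum d = 0.
Proof.
apply: (mulfI q1_neq0).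
by rewrite qsumE (prim_expr_order hq) invr1 subrr mulr0.
Qed.

Section TensorChain.
Variables (l : nat) (hl : (l <= d)%N) (i : int).
Let T : tmod := tmul hq (M hd 0) (M hl i).

(* [ct a b] is [v_a (x) v_b] in [M(2,0) (x) M(l,i)], and [rt] is its dual basis. *)
Definition ct a b : 'cV_(tdim T) := cbase K 2 a *t cbase K l b.
Definition rt a b : 'rV_(tdim T) := rbase K 2 a *t rbase K l b.

Lemma ct_ge a b : (l <= b)%N -> ct a b = 0.
Proof. by move=> le_lb; rewrite /ct [cbase K l b]cbase_ge // tensmx0. Qed.

Lemma rt_ct a b a' b' :
  rt a b *m ct a' b' = [&& a == a', a < 2, b == b' & b < l]%N%:R%:M.
Proof.
rewrite [LHS]tensmx_mulrc !rbase_cbase; apply/matrixP=> x y.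
rewrite !mxE !ord1 /= ?eqxx !mulr1n -natrM mulnb -andbA.
by [].
Qed.

Lemma tg_ct a b : tg T *m ct a b = (omega ^ i * q ^- (a + b)) *: ct a b.
Proof.
rewrite /T /= tensmx_mulc !taftM_g_cbase tensmxZl tensmxZr scalerA.
by rewrite mul1r exprD invfM mulrCA.
Qed.

Lemma th_ct1 b : th T *m ct 1 b = ct 1 b.+1.
Proof.
rewrite /T /= mulmxDl !tensmx_mulc.
by rewrite !taftM_h_cbase mul1mx [cbase K 2 2]cbase_ge // tens0mx addr0.
Qed.

Lemma th_ct0 b : th T *m ct 0 b = ct 0 b.+1 + (omega ^ i * q ^- b) *: ct 1 b.
Proof.
rewrite /T /= mulmxDl !tensmx_mulc.
by rewrite !taftM_h_cbase taftM_g_cbase mul1mx tensmxZr.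
Qed.

Lemma thX_ct1 s b : th T ^+ s *m ct 1 b = ct 1 (b + s).
Proof.
elim: s => [|s IHs]; first by rewrite mul1mx addn0.
by rewrite exprS -mulmxA IHs th_ct1 addnS.
Qed.

Lemma thX_ct0 s b : th T ^+ s *m ct 0 b =
  ct 0 (b + s) + (omega ^ i * q ^- b * qsum s) *: ct 1 (b + s).-1.
Proof.
elim: s => [|s IHs]; first by rewrite mul1mx addn0 qsum0 mulr0 scale0r addr0.
rewrite exprS -mulmxA IHs mulmxDr th_ct0 addnS -addrA; congr (_ + _) => /=.
have -> : omega ^ i * q ^- (b + s) = omega ^ i * q ^- b * q ^- s.
  by rewrite exprD invfM mulrA.
rewrite -scalemxAr th_ct1 qsumSr mulrDr scalerDl addrC; congr (_ + _).
(* For [b = s = 0] the truncated predecessor is not the true index, but its coefficient contains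
   [qsum 0 = 0]. *)
case: s {IHs} => [|s]; first by rewrite qsum0 mulr0 !scale0r.
by rewrite addnS.
Qed.

End TensorChain.

Let w_neq0 (i : int) : omega ^ i != 0.
Proof. by rewrite expfz_neq0 // (prim_root_eq0 hw) -lt0n (prim_order_gt0 hw). Qed.

Local Notation T hl i := (tmul hq (M hd 0) (M hl i)).

(** The vector [v_0 (x) v_0] generates everything. The zero module M(0,0) is added so that
    [tiso_cyclic2] applies. *)
Lemma tmul_M2_M1 (h0 : (0 <= d)%N) (h1 : (1 <= d)%N) i :
  tiso (tplus (M hd i) (M h0 0)) (T h1 i).
Proof.
apply: (@tiso_cyclic2 _ _ _ hd h0 i 0 (ct h1 i 0 0) 0
  ((omega ^ i)^-1 *: rt h1 i 1 0) 0) => //.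
- by rewrite tg_ct expr0 invr1 mulr1.
- rewrite thX_ct0 [_.-1]/= !add0n expr0 invr1 mulr1 ct_ge // add0r ct_ge // scaler0 //.
- by rewrite mulmx0 scaler0.
- by rewrite mulmx0.
- move=> s; rewrite -scalemxAl -scalemxAl -mulmxA thX_ct0 mulmxDr -scalemxAr !rt_ct.
  rewrite !add0n expr0 invr1 mulr1 /= raddf0 add0r.
  case: s => [|[|s]].
  + by rewrite qsum0 mulr0 scale0r scaler0 raddf0.
  + by rewrite /qsum big_ord1 expr0 invr1 mulr1 scalerA mulVf ?scale1r.
  + by rewrite raddf0 !scaler0.
- by move=> s; rewrite mulmx0.
- by move=> s; rewrite !mul0mx.
- by move=> s; rewrite !mul0mx raddf0.
Qed.

Lemma tmul_M2_M l (h : (l.+2 <= d)%N) (hS : (l.+3 <= d)%N) (hP : (l.+1 <= d)%N) i i2 :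
    omega ^ i2 = omega ^ i * q^-1 ->
  tiso (tplus (M hS i) (M hP i2)) (T h i).
Proof.
move=> wi2; set w := omega ^ i.
have wq_neq0 : w * qsum l.+2 != 0 by rewrite mulf_neq0 ?w_neq0 ?qsum_neq0.
(* The long chain starts at [v_0 (x) v_0]. In the weight space of [omega ^ i2], [v2] is the
   combination with [h ^ (l + 1) v2 = 0]. *)
pose v2 := ct h i 0 1 - (w * q^-1 * qsum l.+1) *: ct h i 1 0.
(* The two coordinates are combined to kill [h ^ (l + 1) (v_0 (x) v_0)], and scaled to take the
   value 1 on [h ^ l v2]. *)
pose phi2 := - (w * qsum l.+2)^-1 *:
  (rt h i 1 l - (w * qsum l.+1) *: rt h i 0 l.+1).
have v2X s : th (T h i) ^+ s *m v2 =
    ct h i 0 s.+1 + (w * q^-1 * (qsum s - qsum l.+1)) *: ct h i 1 s.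
  rewrite mulmxBr -scalemxAr thX_ct0 thX_ct1 add1n add0n expr1 mulrBr scalerBl.
  by rewrite addrA.
have v1X s : th (T h i) ^+ s *m ct h i 0 0 =
    ct h i 0 s + (w * qsum s) *: ct h i 1 s.-1.
  by rewrite thX_ct0 expr0 invr1 mulr1 !add0n.
apply: (@tiso_cyclic2 _ _ _ hS hP i i2 (ct h i 0 0) v2
  ((w * qsum l.+2)^-1 *: rt h i 1 l.+1) phi2) => [|||||s|s|s|s].
- by rewrite /= mul2n -addnn !(addnS, addSn).
- by rewrite tg_ct expr0 invr1 mulr1.
- by rewrite v1X !ct_ge // scaler0 addr0.
- by rewrite mulmxBr -scalemxAr !tg_ct wi2 /= scalerBr !scalerA [_ * (_ / _)]mulrC.
- by rewrite v2X subrr mulr0 scale0r addr0 ct_ge.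
- rewrite -!scalemxAl -mulmxA v1X mulmxDr -scalemxAr !rt_ct /= raddf0 add0r.
  rewrite ltnSn andbT; case: s => [|s] /=.
    by rewrite qsum0 mulr0 scale0r scaler0 raddf0.
  rewrite eqSS eq_sym eqSS; case: eqVneq => [->|_]; last by rewrite raddf0 !scaler0.
  by rewrite scalerA mulVf ?scale1r.
- rewrite -!scalemxAl -mulmxA v2X mulmxDr -scalemxAr !rt_ct /= raddf0 add0r.
  rewrite ltnSn andbT; case: eqVneq => [->|_]; last by rewrite raddf0 !scaler0.
  by rewrite subrr mulr0 scale0r scaler0.
- rewrite -!scalemxAl mulmxBl mulmxBl -!scalemxAl -!mulmxA v1X !mulmxDr -!scalemxAr !rt_ct /=.
  rewrite raddf0 add0r scaler0 addr0 ltnSn ltnS leqnSn !andbT.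
  case: s => [|s] /=; first by rewrite qsum0 mulr0 scale0r raddf0 scaler0 subr0 scaler0.
  rewrite eqSS; case: eqVneq => [->|_]; first by rewrite subrr scaler0.
  by rewrite raddf0 !scaler0 subrr scaler0.
- rewrite -!scalemxAl mulmxBl mulmxBl -!scalemxAl -!mulmxA v2X !mulmxDr -!scalemxAr !rt_ct /=.
  rewrite raddf0 add0r scaler0 addr0 ltnSn ltnS leqnSn !andbT !eqSS eq_sym.
  case: eqVneq => [->|_]; last by rewrite raddf0 !scaler0 subr0 scaler0.
  rewrite -scalerBl scalerA -[w / q * _]mulrA -mulrBr mulNr -2!mulrN.
  suff -> : - (q^-1 * (qsum l - qsum l.+1) - qsum l.+1) = qsum l.+2.
    by rewrite mulVf ?scale1r.
  by rewrite [qsum l.+2]qsumS [qsum l.+1]qsumS; ring.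
Qed.

(** As [qsum d = 0], the chain of [v_0 (x) v_0] already stops at length [d], and [v_1 (x) v_0]
    generates a second chain of length [d]. *)
Lemma tmul_M2_Md (hdd : (d <= d)%N) i i2 :
    omega ^ i2 = omega ^ i * q^-1 ->
  tiso (tplus (M hdd i) (M hdd i2)) (T hdd i).
Proof.
move=> wi2.
have v1X s : th (T hdd i) ^+ s *m ct hdd i 0 0 =
    ct hdd i 0 s + (omega ^ i * qsum s) *: ct hdd i 1 s.-1.
  by rewrite thX_ct0 expr0 invr1 mulr1 !add0n.
have v2X s : th (T hdd i) ^+ s *m ct hdd i 1 0 = ct hdd i 1 s by rewrite thX_ct1.
have d1 : (d.-1 < d)%N by rewrite ltn_predL ltnW.
apply: (@tiso_cyclic2 _ _ _ hdd hdd i i2 (ct hdd i 0 0) (ct hdd i 1 0)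
  (rt hdd i 0 d.-1) (rt hdd i 1 d.-1)) => [|||||s|s|s|s].
- by rewrite /= mul2n addnn.
- by rewrite tg_ct expr0 invr1 mulr1.
- by rewrite v1X qsumd mulr0 scale0r addr0 ct_ge.
- by rewrite tg_ct wi2.
- by rewrite v2X ct_ge.
- rewrite -mulmxA v1X mulmxDr -scalemxAr !rt_ct /= raddf0 scaler0 addr0 d1 andbT.
  by rewrite -eqSS prednK ?(ltnW hd) // eq_sym.
- by rewrite -mulmxA v2X rt_ct raddf0.
- rewrite -mulmxA v1X mulmxDr -scalemxAr !rt_ct /= raddf0 add0r d1 andbT.
  case: s => [|s]; first by rewrite qsum0 mulr0 scale0r.
  rewrite -eqSS prednK ?(ltnW hd) //=.
  by case: eqVneq => [<-|_]; rewrite ?qsumd ?mulr0 ?scale0r ?raddf0 ?scaler0.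
- rewrite -mulmxA v2X !rt_ct /= d1 andbT.
  by rewrite -eqSS prednK ?(ltnW hd) // eq_sym.
Qed.

End Tensor.

(** * Generators and commutativity of the Green algebra *)

Lemma commr_lin (F : comNzRingType) (A : algType F) (x : A) c u v :
  GRing.comm x u -> GRing.comm x v -> GRing.comm x (c *: u + v).
Proof.
by move=> xu xv; apply: commrD xv; rewrite /GRing.comm -scalerAr -scalerAl xu.
Qed.

Section GreenGenerators.
Variables (k : comNzRingType) (K : fieldType) (n d : nat) (q omega : K).
Hypotheses (hd : (2 <= d)%N) (hdn : (d %| n)%N) (hq : d.-primitive_root q).
Hypotheses (hw : n.-primitive_root omega) (hwq : omega ^+ (n %/ d) = q).
Hypothesis n_neq0 : n%:R != 0 :> K.
Local Notation tmod := (taftMod n d q).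
Local Notation M hl i := (taftM hdn hq hw hl i).
Local Notation green := (greenAlg k n hq).
Local Notation cl := (gclass k hq).
Local Notation m := (n %/ d)%N.
Local Notation y := (cl (M (ltnW hd) (-1))).
Local Notation z := (cl (M hd 0)).
Implicit Types V W : tmod.

Let w_neq0 : omega != 0.
Proof. by rewrite (prim_root_eq0 hw) -lt0n (prim_order_gt0 hw). Qed.

(** In dimension 0, [V (+) V] is isomorphic to [V], so the class is its own double. *)
Lemma gclass_dim0 V : tdim V = 0 -> cl V = 0.
Proof.
move=> V0; apply: (addrI (cl V)); rewrite addr0 -gclass_plus.
have E0 a b (A B : 'M[K]_(a, b)) : a = 0 -> A = B.
  by move=> a0; apply/matrixP=> i; have := ltn_ord i; rewrite {2}a0.
apply/gclass_iso; exists 0, 0; split; apply: E0 => //=.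
by rewrite V0.
Qed.

Lemma gclass_taftM l (h h' : (l <= d)%N) i i' : omega ^ i = omega ^ i' ->
  cl (M h i) = cl (M h' i').
Proof.
move=> ww; apply/gclass_iso/(@tiso_reindex _ _ _ _ (M h i) (M h' i') id id) => //=.
by move=> a b; rewrite !mxE ww.
Qed.

Lemma gclass_taftM1 (h : (1 <= d)%N) : cl (M h 0) = 1.
Proof.
apply/gclass_iso/(@tiso_reindex _ _ _ _ (M h 0) (tunit n hq) id id) => //= a b;
by rewrite !ord1 !mxE //= expr0 invr1 mulr1.
Qed.

Lemma green_yM l (h : (l <= d)%N) i : y * cl (M h i) = cl (M h (i - 1)).
Proof.
rewrite [LHS]gclassM.
have [o o0] : exists o : 'I_1, o = 0 :> nat by exists ord0.
pose f (a : 'I_l) : 'I_(1 * l) := mxtens_index (o, a).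
pose f' (a : 'I_(1 * l)) := (mxtens_unindex a).2.
apply/gclass_iso/(@tiso_reindex _ _ _ _
  (tmul hq (M (ltnW hd) (-1)) (M h i)) (M h (i - 1)) f f').
- by move=> a; rewrite /f' /f mxtens_indexK.
- by move=> a; case: (mxtens_indexP a) => a1 a2;
    rewrite /f' /f mxtens_indexK [a1]ord1 [o]ord1.
- move=> a b; rewrite /f /= tensmxE !mxE eqxx mulr1n o0 expr0 invr1 mulr1.
  by rewrite expfzDr // mulrnAr -mulrA mulrCA mulrA.
- move=> a b; rewrite /f /= [RHS]mxE !tensmxE !mxE eqxx o0 /=.
  by rewrite !mul1r mul0r addr0.
Qed.

Lemma green_yXM j l (h : (l <= d)%N) i : y ^+ j * cl (M h i) = cl (M h (i - j%:Z)).
Proof.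
elim: j => [|j IHj]; first by rewrite mul1r subr0.
by rewrite exprS -mulrA IHj green_yM -addrA -opprD -PoszD addn1.
Qed.

Lemma green_yn : y ^+ n = 1.
Proof.
rewrite -[LHS]mulr1 -[X in _ * X](gclass_taftM1 (ltnW hd)) green_yXM.
rewrite -[RHS](gclass_taftM1 (ltnW hd)); apply: gclass_taftM.
by rewrite sub0r -exprnN (prim_expr_order hw) invr1.
Qed.

Let w_m i : omega ^ (i - m%:Z) = omega ^ i * q^-1.
Proof. by rewrite expfzDr // -exprnN hwq. Qed.

Lemma green_zM1 (h : (1 <= d)%N) i : z * cl (M h i) = cl (M hd i).
Proof.
rewrite [LHS]gclassM -(gclass_iso _ _ (tmul_M2_M1 hd hdn hq hw (leq0n d) h i)).
by rewrite gclass_plus [cl (M (leq0n d) 0)]gclass_dim0 ?addr0.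
Qed.

Lemma green_zM l (h : (l.+2 <= d)%N) (hS : (l.+3 <= d)%N) (hP : (l.+1 <= d)%N) i :
  z * cl (M h i) = cl (M hS i) + y ^+ m * cl (M hP i).
Proof.
rewrite [LHS]gclassM green_yXM -gclass_plus; apply/esym/gclass_iso.
exact: tmul_M2_M.
Qed.

Lemma green_zMd (h : (d <= d)%N) i :
  z * cl (M h i) = cl (M h i) + y ^+ m * cl (M h i).
Proof.
rewrite [LHS]gclassM green_yXM -gclass_plus; apply/esym/gclass_iso.
exact: tmul_M2_Md.
Qed.

Lemma green_zy : z * y = y * z.
Proof. by rewrite green_zM1 green_yM. Qed.

(** [y] and [z] generate the algebra: [green_zM], solved for its longest term, reaches the M(l,0),
    powers of [y] shift the index, and splitting off summands by induction on the dimension reaches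
    every class. *)
Lemma green_gen (P : green -> Prop) :
    P 1 -> P y -> P z -> (forall a b, P a -> P b -> P (a * b)) ->
    (forall c a b, P a -> P b -> P (c *: a + b)) ->
  forall x, P x.
Proof.
move=> P1 Py Pz PM Plin.
have P0 : P 0 by rewrite -[0](addNr 1) -scaleN1r; apply: Plin.
have PD a b : P a -> P b -> P (a + b) by move=> Pa Pb; rewrite -[a]scale1r; apply: Plin.
have PN a : P a -> P (- a).
  by move=> Pa; rewrite -[- a]addr0 -scaleN1r; apply: Plin.
have PX a j : P a -> P (a ^+ j).
  by move=> Pa; elim: j => // j IHj; rewrite exprS; apply: PM.
have PM0 l (h : (l <= d)%N) : P (cl (M h 0)).
  elim/ltn_ind: l h => -[|[|[|l]]] IHl h.
  - by rewrite gclass_dim0.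
  - by rewrite gclass_taftM1.
  - by rewrite (gclass_taftM h hd (erefl _)).
  - have -> : cl (M h 0) = z * cl (M (ltnW h) 0) - y ^+ m * cl (M (ltnW (ltnW h)) 0).
      by rewrite (green_zM _ h (ltnW (ltnW h))) addrK.
    apply: PD; first by apply: PM => //; apply: IHl.
    by apply: PN; apply: PM; [apply: PX | apply: IHl].
have PM_ l (h : (l <= d)%N) j : P (cl (M h (- j%:Z))).
  by rewrite -[- _]add0r -green_yXM; apply: PM; [apply: PX|].
apply: green_span => // V.
have [N leVN] := ubnP (tdim V); elim: N V leVN => // N IHN V; rewrite ltnS => leVN.
have [V0|V_gt0] := posnP (tdim V); first by rewrite gclass_dim0.
have [l [h [j [W [l_gt0 iW]]]]] := taft_split hdn hq hw n_neq0 V_gt0.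
rewrite -(gclass_iso _ _ iW) gclass_plus; apply: PD; first exact: PM_.
by apply: IHN; apply: leq_trans leVN; rewrite -(tiso_dim iW) /= -addn1 addnC leq_add2r.
Qed.

(** An element commuting with both generators is central. This is applied first to an arbitrary
    element, then to [y] and to [z]. *)
Lemma green_mulC (a b : green) : a * b = b * a.
Proof.
have comm_gen (x : green) : GRing.comm x y -> GRing.comm x z -> forall a, GRing.comm x a.
  move=> xy xz; apply: green_gen xy xz _ _; first exact: commr1.
    by move=> u v; apply: commrM.
  exact: commr_lin.
apply: (comm_gen); apply/esym; apply: (comm_gen).
- exact: erefl.
- exact/esym/green_zy.
- exact: green_zy.
- exact: erefl.
Qed.

End GreenGenerators.

(** * Indecomposable modules over a commutative algebra *)

Section CommModule.
Variables (F : fieldType) (A : algType F) (V : fdModule A).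
Hypothesis mulA : forall a b : A, a * b = b * a.
Local Notation act := (mod_act V).
Local Notation ev x p := (act (horner_alg x p)).

Lemma act_mul a b v : act (a * b) v = act a (act b v).
Proof. by rewrite mod_actM lfunE. Qed.

Lemma lker_submodule a : submodule (lker (act a)).
Proof.
move=> b; apply/subvP=> _ /memv_imgP[v + ->]; rewrite !memv_ker => /eqP av.
by rewrite -act_mul mulA act_mul av linear0.
Qed.

Hypothesis indV : indecomposable V.

(** By Bezout the module is the direct sum of the kernels of [p(x)] and [q(x)], which are submodules
    by commutativity. One kernel is 0, and the image of the factor with the other kernel lies in
    it. *)
Lemma coprime_act x p q : coprimep p q -> ev x (p * q) = 0 ->
  ev x p = 0 \/ ev x q = 0.
Proof.
move=> /Bezout_eq1_coprimepP[[u v] /= uv1] pq0.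
have pq0v (r : {poly F}) w : ev x (r * (p * q)) w = 0.
  by rewrite rmorphM act_mul pq0 lfunE linear0.
have decomp w : ev x (u * p) w + ev x (v * q) w = w.
  by rewrite -add_lfunE -linearD -rmorphD uv1 rmorph1 mod_act1 lfunE.
case: (indV.2 (lker (ev x p)) (lker (ev x q))).
- exact: lker_submodule.
- exact: lker_submodule.
- apply/eqP; rewrite eqEsubv subvf /=; apply/subvP=> w _.
  rewrite -(decomp w) addrC; apply: memv_add; rewrite memv_ker -act_mul -rmorphM.
    by rewrite mulrCA pq0v.
  by rewrite mulrCA [q * p]mulrC pq0v.
- apply/eqP; rewrite -subv0; apply/subvP=> w.
  rewrite memv_cap !memv_ker memv0 => /andP[/eqP pw /eqP qw].
  by rewrite -(decomp w) !rmorphM !act_mul pw qw !linear0 addr0.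
- move=> kerp; right; apply/lfunP=> w; rewrite lfunE; apply/eqP.
  by rewrite -memv0 -kerp memv_ker -act_mul -rmorphM pq0 lfunE.
move=> kerq; left; apply/lfunP=> w; rewrite lfunE; apply/eqP.
by rewrite -memv0 -kerq memv_ker -act_mul -rmorphM mulrC pq0 lfunE.
Qed.

Lemma prod_act x s : uniq s -> ev x (\prod_(a <- s) ('X - a%:P)) = 0 ->
  exists2 a, a \in s & act x = a *: \1%VF.
Proof.
elim: s => [|a s IHs] /=.
  rewrite big_nil rmorph1 mod_act1 => _ id0; case: indV => /negP[].
  by rewrite -subv0; apply/subvP=> w _; rewrite memv0 -[w]id_lfunE id0 lfunE.
case/andP=> a_s uniq_s; rewrite big_cons => /coprime_act[].
- rewrite coprimep_sym coprimep_XsubC.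
  by rewrite root_prod_XsubC.
- rewrite rmorphB /= horner_algX horner_algC linearB linearZ /= mod_act1 => /subr0_eq xa.
  by exists a; rewrite ?mem_head.
by case/(IHs uniq_s)=> b b_s xb; exists b; rewrite // inE b_s orbT.
Qed.

(** Only [c] can be a repeated root. If it is not, [prod_act] makes [x] scalar; if it is, the square
    of its factor is coprime to the product of the others, which cannot act as 0. *)
Lemma act_square_zero x c s : uniq s ->
    ev x (('X - c%:P) * \prod_(r <- s) ('X - r%:P)) = 0 ->
    (forall b, act x <> b *: \1%VF) ->
  c \in s /\ ev x (('X - c%:P) * ('X - c%:P)) = 0.
Proof.
move=> uniq_s ev0 not_scalar.
have not_prod t : uniq t -> ev x (\prod_(r <- t) ('X - r%:P)) <> 0.
  by move=> uniq_t /(prod_act uniq_t)[b _ /not_scalar].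
have [c_s | c_s] := boolP (c \in s); last first.
  by case: (not_prod (c :: s)); rewrite /= ?c_s // big_cons.
split=> //; move: ev0; rewrite (perm_big _ (perm_to_rem c_s)) big_cons mulrA.
case/coprime_act => // [|ev_rem].
  rewrite coprimepMl andbb coprimep_sym coprimep_XsubC root_prod_XsubC.
  by rewrite mem_rem_uniq // inE eqxx.
by case: (not_prod (rem c s)); rewrite ?rem_uniq.
Qed.

End CommModule.

Section ScalarModule.
Variables (F : fieldType) (A : algType F) (V : fdModule A).
Local Notation act := (mod_act V).

(** Every subspace is a submodule, so any vector space complement gives a decomposition. *)
Lemma scalar_irreducible : (forall a, exists c, act a = c *: \1%VF) ->
  indecomposable V -> irreducible V.
Proof.
move=> actC [V_neq0 indV].
have sub U : submodule (V := V) U.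
  move=> a; have [c ->] := actC a; apply/subvP=> _ /memv_imgP[u uU ->].
  by rewrite !lfunE /= lfunE memvZ.
split=> // U _; case: (indV U (U^C)%VS) => //; first exact: addv_complf.
- exact: capv_compl.
- by left.
by move=> UC0; right; rewrite -(addv_complf U) UC0 addv0.
Qed.

End ScalarModule.

(** * Splitting off a Jordan block of size 2 *)

Section SquareZero.
Variables (F : fieldType) (V : vectType F) (N : 'End(V)) (v : V).
Hypotheses (NN0 : forall w, N (N w) = 0) (Nv_neq0 : N v != 0).

Lemma square_zero_free : free [:: N v; v].
Proof.
rewrite free_cons seq1_free span_seq1; apply/andP; split; last first.
  by apply: contraNneq Nv_neq0 => ->; rewrite linear0.
apply: contraNN Nv_neq0 => /vlineP[c Nvc].
have := NN0 v; rewrite {1}Nvc linearZ /= => /eqP; rewrite scaler_eq0.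
by case/orP=> // /eqP c0; rewrite Nvc c0 scale0r.
Qed.

(** Take a form [psi] with [psi (N v) = 1]; the common kernel of [psi] and [psi \o N] is stable
    under [N] since [N] has square 0. *)
Lemma square_zero_complement : exists W : {vspace V},
  [/\ (<<[:: N v; v]>> + W)%VS = fullv, (<<[:: N v; v]>> :&: W)%VS = 0%VS
    & (N @: W <= W)%VS].
Proof.
have [psi psi1] : exists psi : 'Hom(V, F^o), psi (N v) = 1.
  have [i ci] : exists i, coord (vbasis fullv) i (N v) != 0.
    apply/existsP; apply: contraNT Nv_neq0; rewrite negb_exists => /forallP c0.
    rewrite (coord_vbasis (memvf (N v))) big1 // => i _.
    by have := c0 i; rewrite negbK => /eqP ->; rewrite scale0r.
  exists ((coord (vbasis fullv) i (N v))^-1 *: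
    linfun (coord (vbasis fullv) i : V -> F^o)).
  by rewrite lfunE /= lfunE /= [LHS]mulVf.
exists (lker psi :&: lker (psi \o N)%VF)%VS.
have memW w : (w \in (lker psi :&: lker (psi \o N))%VS) =
    (psi w == 0) && (psi (N w) == 0).
  by rewrite memv_cap !memv_ker lfunE.
rewrite span_cons span_seq1; split.
- apply/eqP; rewrite eqEsubv subvf /=; apply/subvP=> w _.
  (* These solve [psi (N w) = b] and [psi w = a + b * psi v], so that the remainder lies in the
     complement. *)
  pose b := psi (N w); pose a := psi w - b * psi v.
  have -> : w = (a *: N v + b *: v) + (w - (a *: N v + b *: v)) by rewrite addrC subrK.
  apply: memv_add; first by apply: memv_add; rewrite memvZ // memv_line.
  rewrite memW !linearB !linearD !linearZ /= psi1 NN0 !linear0 add0r.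
  by rewrite !scalerN /a /b /GRing.scale /= !mulr1 -opprD subrK !subrr eqxx.
- apply/eqP; rewrite -subv0; apply/subvP=> w; rewrite memv_cap memW.
  case/andP=> /memv_addP[_ /vlineP[a ->] [_ /vlineP[b ->] ->]].
  rewrite !linearD !linearZ /= NN0 !linear0 add0r psi1 => /andP[].
  have scale1E (c : F) : c *: (1 : F^o) = c := mulr1 c.
  rewrite !scale1E => + /eqP b0; rewrite b0 scale0r addr0 => /eqP ->.
  by rewrite !scale0r addr0 memv0.
apply/subvP=> _ /memv_imgP[w + ->]; rewrite !memW NN0 linear0 eqxx andbT.
by case/andP.
Qed.

End SquareZero.

(** * The polynomials F_l(a, X) and their roots *)

Section Chebyshev.
Variable F : fieldType.

(* The polynomial [F_l(a, 'X)] of the presentation of the Green algebra. *)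
Fixpoint chebF (a : F) l : {poly F} :=
  match l with
  | 0 => 0
  | l1.+1 => match l1 with 0 => 1 | l2.+1 => 'X * chebF a l1 - a *: chebF a l2 end
  end.

Lemma chebFSS a l : chebF a l.+2 = 'X * chebF a l.+1 - a *: chebF a l.
Proof. by []. Qed.

Lemma size_chebF a l : size (chebF a l.+1) = l.+1 /\ lead_coef (chebF a l.+1) = 1.
Proof.
elim/ltn_ind: l => -[|l] IHl; first by rewrite size_poly1 lead_coef1.
have [sl ll] := IHl l (leqnn _).
have sX : size ('X * chebF a l.+1) = l.+2.
  by rewrite mulrC size_mulX ?sl // -size_poly_eq0 sl.
have lt_s : (size (- (a *: chebF a l))%R < size ('X * chebF a l.+1)%R)%N.
  rewrite sX size_polyN (leq_ltn_trans (size_scale_leq _ _)) //.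
  by case: l {sl ll sX} IHl => [|l] IHl; rewrite ?size_poly0 // (IHl l _).1.
by rewrite chebFSS size_polyDl // sX lead_coefDl // mulrC lead_coefMX ll.
Qed.

(** Binet's formula: [u] and [u'] are the characteristic roots of the recursion at [X = u + u']. *)
Lemma chebF_horner a u u' l : u * u' = a ->
  (u - u') * (chebF a l).[u + u'] = u ^+ l - u' ^+ l.
Proof.
move=> uu'; elim/ltn_ind: l => -[|[|l]] IHl; first by rewrite horner0 mulr0 subrr.
  by rewrite hornerC mulr1.
rewrite chebFSS hornerD hornerN hornerZ hornerM hornerX mulrBr mulrCA IHl //.
by rewrite mulrCA IHl // -uu' !exprS; ring.
Qed.

(* For [a = zeta ^ (2 k)] the roots of [F_d(a, 'X)] are
   [zeta ^ (k + j) + zeta ^ (k - j)] with [0 < j < d]. *)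
Lemma chebF_split d zeta k : (0 < d)%N -> (d.*2).-primitive_root zeta ->
  exists2 s, uniq s & chebF (zeta ^+ k.*2) d = \prod_(r <- s) ('X - r%:P).
Proof.
(* From here on [d] is one less than in the statement. *)
case: d => // d _ hz; have z_neq0 : zeta != 0 by rewrite (prim_root_eq0 hz).
pose r j := zeta ^+ k * (zeta ^+ j + zeta ^- j).
pose s := [seq r j | j <- iota 1 d].
have uniq_s : uniq s.
  rewrite map_inj_in_uniq ?iota_uniq // => i j; rewrite !mem_iota !add1n !ltnS.
  move=> /andP[i_gt0 le_id] /andP[j_gt0 le_jd] /(mulfI (expf_neq0 k z_neq0)) rij.
  (* Equal values of [x + x^-1] force equal or inverse arguments; the latter is excluded by
     [0 < i + j < 2 (d + 1)]. *)
  have : (zeta ^+ i - zeta ^+ j) * (zeta ^+ (i + j) - 1) = 0.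
    transitivity (((zeta ^+ i + zeta ^- i) - (zeta ^+ j + zeta ^- j)) *
                  zeta ^+ i * zeta ^+ j).
      rewrite exprD; field.
      by rewrite !expf_neq0.
    by rewrite rij subrr !mul0r.
  move/eqP; rewrite mulf_eq0 !subr_eq0 (eq_prim_root_expr hz) -(prim_order_dvd hz).
  case/orP=> [/eqP|/dvdn_leq]; last first.
    rewrite addn_gt0 i_gt0 => /(_ isT); rewrite leqNgt; case/negP.
    by rewrite -addnn addnS ltnS addSn (leq_trans (leq_add le_id le_jd)).
  by rewrite !modn_small // -addnn addSn ltnS (leq_trans _ (leq_addr _ _)).
exists s => //.
have [sz lc] := size_chebF (zeta ^+ k.*2) d.
rewrite [LHS](@all_roots_prod_XsubC _ _ s) ?lc ?scale1r //.
- by rewrite sz size_map size_iota.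
- apply/allP=> _ /mapP[j + ->]; rewrite mem_iota add1n ltnS => /andP[j_gt0 le_jd].
  have uu' : (zeta ^+ k * zeta ^+ j) * (zeta ^+ k * zeta ^- j) = zeta ^+ k.*2.
    by rewrite mulrACA divff ?expf_neq0 // mulr1 -exprD addnn.
  (* Hence the two powers in [chebF_horner] agree and its right side is 0, while [u - u'] is nonzero
     because [0 < 2 j < 2 (d + 1)]. *)
  have xx : (zeta ^+ j) ^+ d.+1 * (zeta ^+ j) ^+ d.+1 = 1.
    by rewrite -expr2 -!exprM muln2 mulnC exprM (prim_expr_order hz) expr1n.
  have := chebF_horner d.+1 uu'; rewrite -mulrDr !exprMn exprVn -mulrBr -mulrBr.
  have -> : ((zeta ^+ j) ^+ d.+1)^-1 = (zeta ^+ j) ^+ d.+1.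
    rewrite -[LHS]mulr1 -xx mulKf //; apply: contra_eq_neq xx => ->.
    by rewrite mul0r eq_sym oner_eq0.
  rewrite subrr mulr0 => /eqP; rewrite mulf_eq0 => /orP[|//].
  rewrite mulf_eq0 expf_eq0 (negPf z_neq0) andbF /= subr_eq0 => /eqP zj.
  have : zeta ^+ j.*2 == 1 by rewrite -addnn exprD {1}zj mulVf ?expf_neq0.
  rewrite -(prim_order_dvd hz) => /dvdn_leq; rewrite double_gt0 => /(_ j_gt0).
  by rewrite leq_double ltnNge le_jd.
- by rewrite uniq_rootsE.
Qed.

End Chebyshev.

(** * Complex roots of unity *)

Section RootsOfUnity.
Variable R : realType.

Definition expi (t : R) : R[i] := (cos t +i* sin t)%C.

Lemma expiD s t : expi (s + t) = expi s * expi t.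
Proof. by rewrite /expi cosD sinD; simpc; rewrite [sin s * cos t + _]addrC. Qed.

(** The half angle has positive sine, so [cos t = 1 - 2 sin (t / 2) ^ 2] is less than 1. *)
Lemma expi_neq1 t : 0 < t -> t < 2 * pi -> expi t != 1.
Proof.
move=> t_gt0 t_lt; apply/eqP => -[ct _].
have : 0 < sin (t / 2) by apply: sin_gt0_pi; rewrite divr_gt0 //= ltr_pdivrMr // mulrC.
have := cos_mulr2n (t / 2).
have -> : (t / 2) *+ 2 = t by rewrite -mulr_natr; field.
have := sin2cos2 (t / 2).
rewrite ct; nra.
Qed.

Lemma omegaCE n k : omegaC R n k = expi (2 * k%:R * pi / n%:R).
Proof. by []. Qed.

Lemma omegaCX n k : omegaC R n k = omegaC R n 1 ^+ k.
Proof.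
elim: k => [|k IHk]; first by rewrite omegaCE mulr0 !mul0r /expi cos0 sin0.
rewrite exprS -IHk !omegaCE -expiD; congr expi.
by rewrite -natr1; ring.
Qed.

Lemma omegaC_prim n : (0 < n)%N -> n.-primitive_root (omegaC R n 1).
Proof.
move=> n_gt0; apply/andP; split => //; apply/forallP=> i; apply/eqP.
have n0 : n%:R != 0 :> R by rewrite pnatr_eq0 -lt0n.
rewrite unity_rootE -omegaCX omegaCE.
have [->|ne] := eqVneq i.+1 n.
  apply/eqP; rewrite mulrAC -[2 * _ / _]mulrA divff // mulr1 mulr_natl /expi.
  by rewrite cos2pi sin2pi.
apply/negbTE/expi_neq1.
  by rewrite divr_gt0 ?mulr_gt0 ?pi_gt0 ?ltr0n.
rewrite ltr_pdivrMr ?ltr0n // mulrAC ltr_pM2l ?mulr_gt0 ?pi_gt0 //.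
by rewrite ltr_nat ltn_neqAle ne ltn_ord.
Qed.

Lemma omegaC_dvd n d : (0 < n)%N -> (d %| n)%N -> omegaC R n (n %/ d) = omegaC R d 1.
Proof.
move=> n_gt0 dn; rewrite !omegaCE; congr expi.
have d_gt0 : (0 < d)%N by apply: dvdn_gt0 dn.
have d0 : d%:R != 0 :> R by rewrite pnatr_eq0 -lt0n.
have m0 : (n %/ d)%:R != 0 :> R by rewrite pnatr_eq0 -lt0n divn_gt0 // dvdn_leq.
by rewrite -{2}(divnK dn) natrM; field; rewrite d0 m0.
Qed.

End RootsOfUnity.

(** * The action of y and z on an indecomposable module *)

Lemma act_horner_XB (F : fieldType) (A : algType F) (V : fdModule A) x p c r :
  mod_act V (horner_alg x ('X * p - c *: r)) =
  (mod_act V x \o mod_act V (horner_alg x p))%VF - c *: mod_act V (horner_alg x r).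
Proof.
by rewrite linearB linearB rmorphM /= horner_algX mod_actM linearZ /= mulr_algl linearZ.
Qed.

Section GreenModule.
Variables (R : realType) (K : fieldType) (n d : nat) (q omega : K).
Hypotheses (hd : (2 <= d)%N) (hdn : (d %| n)%N) (hq : d.-primitive_root q).
Hypotheses (hw : n.-primitive_root omega) (hwq : omega ^+ (n %/ d) = q).
Hypothesis n_neq0 : n%:R != 0 :> K.
Variable V : fdModule (GreenC R n hq).
Hypothesis indV : indecomposable V.
Local Notation A := (GreenC R n hq).
Local Notation act := (mod_act V).
Local Notation y := (green_y R hd hdn hq hw).
Local Notation z := (green_z R hd hdn hq hw).
Local Notation m := (n %/ d)%N.

Lemma GreenC_gen (P : A -> Prop) :
    P 1 -> P y -> P z -> (forall a b, P a -> P b -> P (a * b)) ->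
    (forall c a b, P a -> P b -> P (c *: a + b)) ->
  forall x, P x.
Proof. exact: green_gen. Qed.

Lemma GreenC_mulC (a b : A) : a * b = b * a.
Proof. exact: (green_mulC hd hdn hw hwq n_neq0). Qed.

(** [y ^ n = 1], and [X ^ n - 1] has the [n] distinct roots [omegaC R n k]. *)
Lemma act_y_scalar :
  exists2 k, (k < n)%N & act y = omegaC R n k *: \1%VF.
Proof.
have n_gt0 := prim_order_gt0 hw.
have prod_omega : \prod_(a <- [seq omegaC R n k | k <- iota 0 n]) ('X - a%:P) = 'X^n - 1.
  rewrite big_map -(factor_Xn_sub_1 (omegaC_prim R n_gt0)) /index_iota subn0.
  by apply: eq_bigr => k _; rewrite -omegaCX.
have [||a] := @prod_act _ _ V GreenC_mulC indV y [seq omegaC R n k | k <- iota 0 n].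
- rewrite map_inj_in_uniq ?iota_uniq // => i j; rewrite !mem_iota /= add0n => lt_in lt_jn.
  rewrite (omegaCX _ _ i) (omegaCX _ _ j) => /eqP.
  by rewrite (eq_prim_root_expr (omegaC_prim R n_gt0)) !modn_small // => /eqP.
- rewrite prod_omega rmorphB rmorph1 rmorphXn /= horner_algX.
  by rewrite [y ^+ n]green_yn subrr linear0.
by case/mapP=> k; rewrite mem_iota /= add0n => lt_kn -> yk; exists k.
Qed.

Section ScalarY.
Variables (w : R[i]).
Hypothesis act_y : act y = w *: \1%VF.
Local Notation ev p := (act (horner_alg z p)).

Lemma act_yM x : act (y ^+ m * x) = w ^+ m *: act x.
Proof.
elim: {1 2}m => [|j IHj]; first by rewrite mul1r scale1r.
rewrite exprS -mulrA; apply/lfunP=> v.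
by rewrite act_mul IHj act_y !scale_lfunE id_lfunE scalerA -exprS.
Qed.

Local Notation M h := (gclass R[i] hq (taftM hdn hq hw h 0)).

Lemma act_zM_recursion l (h : (l.+3 <= d)%N) (h1 : (l.+2 <= d)%N) (h2 : (l.+1 <= d)%N) :
  act (M h) = (act z \o act (M h1))%VF - w ^+ m *: act (M h2).
Proof.
rewrite -mod_actM -act_yM -linearB; congr (act _); apply/esym/eqP.
by rewrite subr_eq; apply/eqP; exact: green_zM.
Qed.

Lemma act_zMd (h : (d <= d)%N) : (act z \o act (M h))%VF = (1 + w ^+ m) *: act (M h).
Proof.
rewrite -mod_actM scalerDl scale1r -act_yM -linearD; congr (act _).
exact: green_zMd.
Qed.

(** With [y] acting as [w], the rule for [z] times M(l,0) becomes the recursion of [chebF]. *)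
Lemma act_taftM l (h : (l <= d)%N) : act (M h) = ev (chebF (w ^+ m) l).
Proof.
elim/ltn_ind: l h => -[|[|[|l]]] IHl h.
- by rewrite gclass_dim0 //= rmorph0.
- by rewrite gclass_taftM1 /= rmorph1.
- rewrite /= scaler0 subr0 mulr1 horner_algX.
  by congr (act _); apply: gclass_taftM.
rewrite (act_zM_recursion h (ltnW h) (ltnW (ltnW h))).
rewrite (IHl l.+2 (ltnSn _) (ltnW h)) (IHl l.+1 (ltnW (ltnSn _)) (ltnW (ltnW h))).
exact/esym/act_horner_XB.
Qed.

Lemma ev_relation : ev (('X - (1 + w ^+ m)%:P) * chebF (w ^+ m) d) = 0.
Proof.
rewrite mulrBl mul_polyC act_horner_XB -(act_taftM (leqnn d)) act_zMd.
by rewrite subrr.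
Qed.

Lemma act_z_scalar_irreducible b : act z = b *: \1%VF -> irreducible V.
Proof.
move=> act_z; apply: scalar_irreducible (indV).
apply: GreenC_gen.
- by exists 1; rewrite mod_act1 scale1r.
- by exists w.
- by exists b.
- move=> u v [cu Eu] [cv Ev]; exists (cu * cv); apply/lfunP=> x.
  by rewrite act_mul Eu Ev !scale_lfunE !id_lfunE scalerA.
- move=> c u v [cu Eu] [cv Ev]; exists (c * cu + cv).
  by rewrite linearD linearZ /= Eu Ev scalerA scalerDl.
Qed.

Lemma ev_XsubC c : ev ('X - c%:P) = act z - c *: \1%VF.
Proof.
by rewrite linearB /= horner_algX horner_algC linearB linearZ /= mod_act1.
Qed.

(** [y] acts as a scalar and [z] differs from [z - c] by a scalar, so stability under the generators
    is automatic. *)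
Lemma submodule_ev c (U : {vspace V}) : (ev ('X - c%:P) @: U <= U)%VS -> submodule U.
Proof.
move=> NU; apply: GreenC_gen.
- by rewrite mod_act1 lim1g.
- apply/subvP=> _ /memv_imgP[x xU ->].
  by rewrite act_y scale_lfunE id_lfunE memvZ.
- apply/subvP=> _ /memv_imgP[x xU ->].
  have -> : act z x = ev ('X - c%:P) x + c *: x.
    by rewrite ev_XsubC add_lfunE opp_lfunE scale_lfunE id_lfunE subrK.
  by apply: memvD; [apply: (subvP NU); apply: memv_img | apply: memvZ].
- by move=> u v uU vU; rewrite mod_actM limg_comp (subv_trans (limgS _ vU)).
- move=> e u v uU vU; rewrite linearD linearZ /=; apply/subvP=> _ /memv_imgP[x xU ->].
  rewrite add_lfunE scale_lfunE memvD ?memvZ //.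
    by apply: (subvP uU); rewrite memv_img.
  by apply: (subvP vU); rewrite memv_img.
Qed.

End ScalarY.
End GreenModule.

(** This is the degenerate case [u = u' = 1], where [chebF_horner] gives no information. *)
Lemma chebF1_horner2 (F : fieldType) l : (chebF 1 l).[1 + 1] = l%:R :> F.
Proof.
elim/ltn_ind: l => -[|[|l]] IHl; first by rewrite horner0.
  by rewrite hornerC.
rewrite chebFSS hornerD hornerN hornerZ hornerM hornerX !IHl //.
by rewrite -!natr1; ring.
Qed.

(** * Identification with V(k) *)

Theorem theorem5p5 (K : closedFieldType) (hK : [pchar K] =i pred0)
    (n d : nat) (hn : (2 <= n)%N) (hd : (2 <= d)%N) (hdn : (d %| n)%N)
    (q : K) (hq : d.-primitive_root q)
    (omega : K) (hw : n.-primitive_root omega) (hwq : omega ^+ (n %/ d) = q)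
    (R : realType) (V : fdModule (GreenC R n hq)) :
  indecomposable V -> ~ irreducible V ->
  exists k : nat, [/\ (k <= n - 1)%N, ~~ (d %| k)%N & iso_Vk hd hdn hw V k].
Proof.
move=> indV redV.
have n_gt0 : (0 < n)%N by exact: ltnW.
have d_gt0 : (0 < d)%N by exact: ltnW.
have n_neq0 : n%:R != 0 :> K by rewrite ((pcharf0P K).1 hK) -lt0n.
have [k lt_kn act_y] := act_y_scalar hd hdn hw hwq n_neq0 indV.
set w := omegaC R n k in act_y; pose a := w ^+ (n %/ d); pose c := 1 + a.
(* [chebF_split] wants [a] as an even power of a primitive [2 d]-th root of unity; indeed
   [a = zeta ^ (2 k)]. *)
have z_prim : (d.*2).-primitive_root (omegaC R d.*2 1).
  by apply: omegaC_prim; rewrite double_gt0.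
set zeta := omegaC R d.*2 1 in z_prim.
have z2 : zeta ^+ 2 = omegaC R d 1.
  rewrite -omegaCX -(@omegaC_dvd R d.*2) ?double_gt0 ?dvdn_double //.
    by rewrite -mul2n mulnK.
  by rewrite -muln2 dvdn_mulr.
have aE : a = zeta ^+ k.*2.
  rewrite -muln2 mulnC exprM z2 -(omegaC_dvd R n_gt0 hdn) /a /w.
  by rewrite (omegaCX _ n k) (omegaCX _ n (n %/ d)) -!exprM mulnC.
have [s uniq_s chebE] := chebF_split k d_gt0 z_prim.
have := ev_relation hwq act_y; rewrite -/a aE chebE -aE -/c.
case/(act_square_zero (GreenC_mulC hd hdn hw hwq n_neq0) indV uniq_s)
  => [b act_z|c_s NN0].
  by apply: redV; apply: (act_z_scalar_irreducible hwq n_neq0 indV act_y act_z).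
set N := mod_act V (horner_alg (green_z R hd hdn hq hw) ('X - c%:P)).
have NE v : mod_act V (green_z R hd hdn hq hw) v = N v + c *: v.
  by rewrite /N ev_XsubC add_lfunE opp_lfunE scale_lfunE id_lfunE subrK.
have NN v : N (N v) = 0 by rewrite -act_mul -rmorphM NN0 lfunE.
have [v Nv_neq0] : exists v, N v != 0.
  apply: contrapT => N0; apply: redV.
  apply: (act_z_scalar_irreducible hwq n_neq0 indV act_y (b := c)).
  apply/lfunP=> v; rewrite NE scale_lfunE id_lfunE.
  have [->|Nv_neq0] := eqVneq (N v) 0; first by rewrite add0r.
  by case: N0; exists v.
have subN U : (N @: U <= U)%VS -> submodule U.
  exact: (submodule_ev hwq n_neq0 act_y).
(* The span of [N v] and [v] is a nonzero summand, hence the whole module. *)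
have [W [UW_full UW0 NW]] := square_zero_complement NN Nv_neq0.
have NU : (N @: <<[:: N v; v]>> <= <<[:: N v; v]>>)%VS.
  by rewrite limg_span /= NN; apply/span_subvP=> u; rewrite !inE => /orP[] /eqP->;
    rewrite ?mem0v // memv_span ?mem_head.
have [U0 | W0] := indV.2 _ _ (subN _ NU) (subN _ NW) UW_full UW0.
  case/negP: Nv_neq0; rewrite -memv0 -U0.
  by rewrite memv_span ?mem_head.
exists k; split; first by rewrite subn1 -ltnS prednK.
  (* If [d] divided [k], then [a = 1] and [c = 2] would be a root of F_d(1, X), whose value at 2 is
     [d]. *)
  apply/negP => d_k; have a1 : a = 1.
    apply/eqP; rewrite aE -(prim_order_dvd z_prim) -!muln2 dvdn_pmul2r //.
  have := chebF1_horner2 R[i] d.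
  have -> : chebF (1 : R[i]) d = \prod_(r <- s) ('X - r%:P) by rewrite -chebE -aE a1.
  have -> : 1 + 1 = c by rewrite /c a1.
  have /eqP -> : root (\prod_(r <- s) ('X - r%:P)) c by rewrite root_prod_XsubC.
  by move/esym/eqP; rewrite pnatr_eq0 gtn_eqF.
exists (N v), v; split.
- apply/andP; split; last exact: square_zero_free.
  by rewrite -UW_full W0 addv0.
- by rewrite act_y scale_lfunE id_lfunE.
- by rewrite act_y scale_lfunE id_lfunE.
- by rewrite NE NN add0r.
- by rewrite NE.
Qed.
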